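(* Let $G,H$ be finitely generated groups, let $S$ be a finite symmetric generating set of $H$, let $F\subset G$ be a finite set, and let $\operatorname{T}$ be the subshift of bounded actions of $H$ on $G$ with parameters $S,F$. Then: (1) For every subshift $X\subset A^H$ we have $m(\operatorname{T}[X])\ge m(\operatorname{T})\vee m(X)$. (2) Suppose that $G$ is recursively presented and that there is a translation-like action $\ast$ of $H$ on $G$ with $g^{-1}(g\ast s)\in F$ for all $g\in G$, $s\in S$, which is computable and has decidable orbit membership problem. Then for every subshift $X\subset A^H$ we have $m(\operatorname{T}[X])=m(X)$.
   Context: Alphabets are finite. For a group $G$ and alphabet $A$, $A^G=\{x\colon G\to A\}$ carries the prodiscrete topology and the shift action $(gx)(h)=x(g^{-1}h)$. A $G$-subshift is a closed $G$-invariant set $X\subset A^G$. Medvedev degrees: for $P,Q\subset\{0,1\}^{\mathbb N}$ write $P\le Q$ if there is a partial computable function $\Psi$ on $\{0,1\}^{\mathbb N}$ (a Turing functional) defined on all of $Q$ with $\Psi(Q)\subset P$. The Medvedev degree $m(P)$ is the class of $P$ under the equivalence $P\le Q\le P$; the degrees form a lattice with supremum $\vee$ and maximum $m(\varnothing)$. For a group $G$ with finite generating set $R$, free group $F(R)$ and canonical epimorphism $\rho\colon F(R)\to G$, the pullback of a subshift $X\subset A^G$ is $\widehat X=\{x\circ\rho: x\in X\}\subset A^{F(R)}$. Via a computable bijection $\mathbb N\to F(R)$ and a fixed-length binary coding of $A$, $\widehat X$ is identified with a subset of $\{0,1\}^{\mathbb N}$, and $m(X):=m(\widehat X)$ (independent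 of choices). Bounded actions: let $B=F^S$ be the set of maps $S\to F$. For $x\in B^G$, $g\in G$, define $\Phi(g,x,\epsilon)=g$ and $\Phi(g,x,ws)=\Phi(g,x,w)\cdot x(\Phi(g,x,w))(s)$ for $w\in S^*$, $s\in S$. The subshift of bounded actions $\operatorname{T}\subset B^G$ is the set of $x\in B^G$ such that $\Phi(g,x,w)=g$ for all $g\in G$ and all $w\in S^*$ representing $1_H$. For $x\in\operatorname{T}$ and $h\in H$ put $\Phi(g,x,h)=\Phi(g,x,w)$ for any $w\in S^*$ representing $h$. For a subshift $X\subset A^H$, $\operatorname{T}[X]\subset(A\times B)^G$ is the set of $(x,y)\in A^G\times B^G$ with $y\in\operatorname{T}$ and $(x(\Phi(g,y,h)))_{h\in H}\in X$ for every $g\in G$; it is a (possibly empty) $G$-subshift. A right action $\ast$ of $H$ on the set $G$ is translation-like if it is free and bounded, i.e. for each $s\in S$ the set $\{g^{-1}(g\ast s):g\in G\}$ is finite. Fixing a finite symmetric generating set $R$ of $G$, the action is computable if there is a computable map $R^*\times S^*\to R^*$ sending each pair of words $(u,w)$ representing $(g,h)$ to a word representing $g\ast h$; it has decidable orbit membership problem if there is an algorithm deciding, given $u,v\in R^*$, whether the elements of $G$ they represent lie in the same $H$-orbit. A finitely generated group is recursively presented if the set of words in a finite generating set representing the identity is recursively enumerable. *)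

(* Defs.v *)
From mathcomp Require Import all_boot finmap.
From mathcomp Require Import all_classical topology function_spaces.

Set Implicit Arguments.
Unset Strict Implicit.
Unset Printing Implicit Defensive.

Local Open Scope classical_set_scope.
Local Open Scope group_scope.

(* ------------------------------------------------------------------------ *)
(* Oracle computability: Kleene's mu-recursive functions with an oracle.    *)
(* ------------------------------------------------------------------------ *)

Definition cantor : Type := nat -> bool.

Inductive prog : Type :=
| Zero
| Succ
| Proj of nat
| Oracle
| Comp of prog & seq prog
| Prec of prog & prog
| Mu of prog.

(* [sem o p xs y]: with oracle [o], the program [p] halts on the argument     *)
(* list [xs] and returns [y].  Missing arguments are read as 0.               *)
Fixpoint sem (o : cantor) (p : prog) : seq nat -> nat -> Prop :=
  match p with
  | Zero => fun xs y => y = 0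
  | Succ => fun xs y => y = (nth 0 xs 0).+1
  | Proj i => fun xs y => y = nth 0 xs i
  | Oracle => fun xs y => y = nat_of_bool (o (nth 0 xs 0))
  | Comp f gs => fun xs y =>
      exists2 ys,
        (fix sems gs ys := match gs, ys with
           | [::], [::] => True
           | g :: gs', z :: ys' => sem o g xs z /\ sems gs' ys'
           | _, _ => False
           end) gs ys
        & sem o f ys y
  | Prec f g => fun xs y =>
      (fix rec n z := match n with
         | 0 => sem o f (behead xs) z
         | n'.+1 => exists2 t, rec n' t & sem o g [:: n', t & behead xs] z
         end) (nth 0 xs 0) y
  | Mu f => fun xs n =>
      sem o f (n :: xs) 0 /\
      forall m, (m < n)%N -> exists k, sem o f (m :: xs) k.+1
  end.

(* Oracle-free computability: run with the (computable) zero oracle. *)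
Definition run : prog -> seq nat -> nat -> Prop := sem (fun=> false).

(* The Turing functional of index [p] is defined at [x], with value [y]. *)
Definition functional (p : prog) (x y : cantor) : Prop :=
  forall n, sem x p [:: n] (nat_of_bool (y n)).

(* Finite words over a finite alphabet as numbers. *)
Definition wcode (L : finType) (w : seq L) : nat :=
  CodeSeq.code [seq nat_of_ord (enum_rank a) | a <- w].

Definition re_words (L : finType) (W : set (seq L)) : Prop :=
  exists p, forall w, W w <-> exists y, run p [:: wcode w] y.

(* ------------------------------------------------------------------------ *)
(* Medvedev degrees                                                         *)
(* ------------------------------------------------------------------------ *)

Definition medvedev_le (P Q : set cantor) : Prop :=
  exists p, forall x, Q x -> exists2 y, functional p x y & P y.

Definition medvedev_eq (P Q : set cantor) : Prop :=
  medvedev_le P Q /\ medvedev_le Q P.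

(* A degree is an equivalence class, i.e. a collection of subsets. *)
Definition mdegree (P : set cantor) : set (set cantor) :=
  [set Q | medvedev_eq P Q].

Definition mle (c d : set (set cantor)) : Prop :=
  exists P Q, [/\ c P, d Q & medvedev_le P Q].

Definition interleave (x y : cantor) : cantor :=
  fun n => if odd n then y n./2 else x n./2.

Definition mjoin (P Q : set cantor) : set cantor :=
  [set z | exists x y, [/\ P x, Q y & z = interleave x y]].

(* The supremum of the degrees of [P] and [Q] is the degree of [mjoin P Q]. *)
Definition msup (c d : set (set cantor)) : set (set cantor) :=
  [set R | exists P Q, [/\ c P, d Q & medvedev_eq (mjoin P Q) R]].

(* ------------------------------------------------------------------------ *)
(* Finitely generated groups                                                *)
(* ------------------------------------------------------------------------ *)

Section Words.
Variables (G : groupType) (R : {fset G}).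

(* Words in R^*, and words in the letters r = (r, false), r^-1 = (r, true).   *)
Definition wval (w : seq R) : G := \prod_(r <- w) fsval r.

Definition letter (a : R * bool) : G :=
  if a.2 then (fsval a.1)^-1 else fsval a.1.

Definition swval (w : seq (R * bool)) : G := \prod_(a <- w) letter a.

Definition generates : Prop := forall g, exists w, swval w = g.

Definition symmetric_set : Prop := {in R, forall r, r^-1 \in R}.

Definition reduced (w : seq (R * bool)) : bool :=
  sorted (fun a b => ~~ ((a.1 == b.1) && (a.2 != b.2))) w.

(* The free group F(R), realized by reduced words; [rho] is the canonical     *)
(* map onto G when R generates G.                                             *)
Definition freegrp : Type := {w : seq (R * bool) | reduced w}.

Definition rho (u : freegrp) : G := swval (sval u).

End Words.

Definition finitely_generated (G : groupType) : Prop :=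
  exists R : {fset G}, generates R.

Definition recursively_presented (G : groupType) : Prop :=
  exists2 R : {fset G}, generates R &
    re_words [set w : seq (R * bool) | swval w = 1].

(* ------------------------------------------------------------------------ *)
(* Subshifts and their Medvedev degrees                                     *)
(* ------------------------------------------------------------------------ *)

Definition shift (G : groupType) (A : Type) (g : G) (x : G -> A) : G -> A :=
  fun h => x (g^-1 * h).

Definition subshift (G : groupType) (A : finType) (X : set (G -> A)) : Prop :=
  closed (X : set (prod_topology (fun _ : G => discrete_topology A))) /\
  forall g x, X x -> X (shift g x).

(* The choices entering the definition of m(X), for X a subset of A^G: a      *)
(* finite generating set R of G, a computable bijection from the natural      *)
(* numbers to F(R) and a binary coding of A of fixed positive length.         *)
Record coding (G : groupType) (A : finType) : Type := Coding {
  gens : {fset G};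
  gens_generate : generates gens;
  enumF : nat -> freegrp gens;
  enumF_bij : bijective enumF;
  enumF_computable :
    exists p, forall n, run p [:: n] (wcode (sval (enumF n)));
  len : nat;
  bits : A -> len.+1.-tuple bool;
  bits_inj : injective bits
}.

Section Degree.
Variables (G : groupType) (A : finType) (c : coding G A).

Definition pullback (X : set (G -> A)) : set (freegrp (gens c) -> A) :=
  [set x \o @rho G (gens c) | x in X].

(* The concatenation of the code words of z (enumF 0), z (enumF 1), ... *)
Definition encode (z : freegrp (gens c) -> A) : cantor :=
  fun n => nth false (bits c (z (enumF c (n %/ (len c).+1)))) (n %% (len c).+1).

Definition medvedev_degree (X : set (G -> A)) : set (set cantor) :=
  mdegree (encode @` pullback X).

End Degree.

(* ------------------------------------------------------------------------ *)
(* Bounded actions                                                          *)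
(* ------------------------------------------------------------------------ *)

Section BoundedActions.
Variables (G H : groupType) (S : {fset H}) (F : {fset G}).

Let B : finType := {ffun S -> F}.

Definition Phi (g : G) (x : G -> B) (w : seq S) : G :=
  foldl (fun k s => k * fsval (x k s)) g w.

Definition bounded_actions : set (G -> B) :=
  [set x | forall g (w : seq S), wval w = 1 -> Phi g x w = g].

(* A word in S^* representing [h]; it exists if S is symmetric and generates. *)
Definition word_of (h : H) : seq S := xget [::] [set w : seq S | wval w = h].

Definition PhiH (g : G) (x : G -> B) (h : H) : G := Phi g x (word_of h).

Definition bounded_actions_over (A : finType) (X : set (H -> A)) :
    set (G -> A * B) :=
  [set z | bounded_actions (fun g => (z g).2) /\
           forall g, X (fun h => (z (PhiH g (fun k => (z k).2) h)).1)].

End BoundedActions.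

Arguments bounded_actions {G H} S F.
Arguments bounded_actions_over {G H} S F {A} X.

(* ------------------------------------------------------------------------ *)
(* Translation-like actions                                                 *)
(* ------------------------------------------------------------------------ *)

Section TranslationLike.
Variables (G H : groupType) (R : {fset G}) (S : {fset H}) (act : G -> H -> G).

Definition right_action : Prop :=
  (forall g, act g 1 = g) /\
  (forall g h k, act g (h * k) = act (act g h) k).

Definition translation_like : Prop :=
  [/\ right_action,
      forall g h, act g h = g -> h = 1
    & forall s, s \in S -> finite_set [set g^-1 * act g s | g in [set: G]]].

Definition computable_action : Prop :=
  exists p, forall (u : seq R) (w : seq S), exists v : seq R,
    run p [:: wcode u; wcode w] (wcode v) /\
    wval v = act (wval u) (wval w).

Definition same_orbit (g k : G) : Prop := exists h, act g h = k.

Definition decidable_orbits : Prop :=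
  exists p, forall u v : seq R, exists b : bool,
    run p [:: wcode u; wcode v] (nat_of_bool b) /\
    (b <-> same_orbit (wval u) (wval v)).

End TranslationLike.

(* Main.v *)
Require Import Defs.
From Stdlib Require List.
From mathcomp Require Import all_boot finmap.
From mathcomp Require Import all_classical.

(* (1) From a configuration (x, y) of T[X] one reads y off directly, and the
   configuration h |-> x(Phi(1, y, h)) of X by walking along a word in S for h and
   asking the oracle at each step.

   (2) The displacements y(g)(s) = g^-1 (g * s) of the translation-like action are
   computable: search for the f in F with g f = g * s, the equality being
   semi-decidable as G is recursively presented.  In each orbit the first element
   in an enumeration of words is computable, as orbit membership is decidable; call
   it r.  Searching for the h with r * h = g gives a computable map g |-> h(g) with
   h(g * k) = h(g) k, so that x o h restricted to any orbit is a translate of x. *)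

Set Implicit Arguments.
Unset Strict Implicit.
Unset Printing Implicit Defensive.

(** * Programs *)

Arguments sem : simpl never.

(** The word problem of $G$ need not be decidable, so no program may rely on deciding an equality in
    $G$. Every such comparison is placed inside a search known to succeed, run jointly over
    candidates and halting stages. This requires presenting recursively enumerable sets as
    projections of decidable relations, hence the step-bounded evaluator [eval]. For the same reason
    the base point of an orbit is chosen as a word: words in one orbit pass the same orbit tests, so
    the very same word is found, and freeness makes the coordinate in $H$ independent of the search
    that produced it. The codings may use arbitrary generating sets; changing generators only takes
    a finite table of words, which can be built into a program whatever its origin. Programs must
    also halt on oracles that encode no configuration, so reading a letter has a default value,
    taken from a point of the set; the empty set is treated separately. *)

Definition sems (o : cantor) (xs : seq nat) : seq prog -> seq nat -> Prop :=
  fix sems gs ys := match gs, ys with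
    | [::], [::] => True
    | g :: gs', z :: ys' => sem o g xs z /\ sems gs' ys'
    | _, _ => False
    end.

Lemma semComp o f gs xs y :
  sem o (Comp f gs) xs y = (exists2 ys, sems o xs gs ys & sem o f ys y).
Proof. by []. Qed.

(** Like [sems], a named copy of a fixpoint local to [sem]: inductions can then be stated about it,
    and [semComp] and [semPrec] hold by conversion. *)
Definition sem_rec (o : cantor) (f g : prog) (xs : seq nat) : nat -> nat -> Prop :=
  fix rec n z := match n with
    | 0 => sem o f (behead xs) z
    | n'.+1 => exists2 t, rec n' t & sem o g [:: n', t & behead xs] z
    end.

Lemma semPrec o f g xs y :
  sem o (Prec f g) xs y = sem_rec o f g xs (nth 0 xs 0) y.
Proof. by []. Qed.

(** The generated principle gives no hypothesis for the programs in the list of a [Comp]; the nested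
    recursion recovers it. *)
Lemma prog_nested_ind (P : prog -> Prop) :
  P Zero -> P Succ -> (forall i, P (Proj i)) -> P Oracle ->
  (forall f gs, P f -> (forall g, List.In g gs -> P g) -> P (Comp f gs)) ->
  (forall f g, P f -> P g -> P (Prec f g)) ->
  (forall f, P f -> P (Mu f)) -> forall p, P p.
Proof.
move=> h0 hS hi ho hC hP hM; fix IH 1; case=> [||i||f gs|f g|f].
- exact: h0.
- exact: hS.
- exact: hi.
- exact: ho.
- apply: hC; first exact: IH.
  elim: gs => [|g gs IHgs] g' /=; first by case.
  by case=> [<-|]; [exact: IH|exact: IHgs].
- by apply: hP; exact: IH.
- by apply: hM; exact: IH.
Qed.

Lemma sem_proj o i xs : sem o (Proj i) xs (nth 0 xs i).
Proof. by []. Qed.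

Lemma sem_comp1 o f g xs y z :
  sem o g xs y -> sem o f [:: y] z -> sem o (Comp f [:: g]) xs z.
Proof. by move=> hg hf; exists [:: y]. Qed.

Lemma sem_comp2 o f g1 g2 xs y1 y2 z :
  sem o g1 xs y1 -> sem o g2 xs y2 -> sem o f [:: y1; y2] z ->
  sem o (Comp f [:: g1; g2]) xs z.
Proof. by move=> h1 h2 hf; exists [:: y1; y2]. Qed.

(** Here [h] lists all intermediate values of the recursion and so supplies the witnesses hidden in
    [sem_rec]. *)
Lemma sem_prec o f g (h : nat -> nat) n xs :
  sem o f xs (h 0) -> (forall m, sem o g [:: m, h m & xs] (h m.+1)) ->
  sem o (Prec f g) (n :: xs) (h n).
Proof.
move=> h0 hS; rewrite semPrec /=.
by elim: n => [//|n IHn] /=; exists (h n).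
Qed.

Fixpoint constP n := if n is m.+1 then Comp Succ [:: constP m] else Zero.

Lemma sem_const o n xs : sem o (constP n) xs n.
Proof. by elim: n => [//|n IHn]; apply: sem_comp1 IHn _. Qed.

(** This is the step of [CodeSeq.code], so that [eseq] agrees with [wcode]. It is never 0, which
    leaves 0 to the empty sequence. *)
Definition pairc a m := 2 ^ a * m.*2.+1.

Definition addP := Prec (Proj 0) (Comp Succ [:: Proj 1]).
Definition doubleP := Comp addP [:: Proj 0; Proj 0].
Definition pairP := Prec (Comp Succ [:: doubleP]) (Comp doubleP [:: Proj 1]).
Definition complP := Prec (constP 1) Zero.
Definition oddP := Prec Zero (Comp complP [:: Proj 1]).
Definition halfP := Prec Zero (Comp addP [:: Comp oddP [:: Proj 0]; Proj 1]).
Definition shiftP := Prec (Proj 0) (Comp halfP [:: Proj 1]).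
(* [pairc a m] is a nonzero number with [a] trailing zero bits, followed by a
   one and by [m]; the test below is 0 as soon as the last bit is a one. *)
Definition headP :=
  Mu (Comp (Prec (Proj 0) Zero) [:: Comp oddP [:: shiftP]; Proj 1]).
Definition tailP := Comp halfP [:: Comp shiftP [:: headP; Proj 0]].

Lemma sem_add o a b xs : sem o addP [:: a, b & xs] (a + b).
Proof.
by apply: (sem_prec (h := addn^~ b)) => // m; apply: sem_comp1 (sem_proj _ _ _) _.
Qed.

Lemma sem_double o a xs : sem o doubleP (a :: xs) a.*2.
Proof.
apply: sem_comp2 (sem_proj _ _ _) (sem_proj _ _ _) _.
by rewrite -addnn; apply: sem_add.
Qed.

Lemma sem_pair o a m xs : sem o pairP [:: a, m & xs] (pairc a m).
Proof.
apply: (sem_prec (h := pairc^~ m)) => [|b].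
  by rewrite /pairc mul1n; apply: sem_comp1 (sem_double _ _ _) _.
apply: sem_comp1 (sem_proj _ _ _) _; rewrite /pairc expnS -mulnA mul2n.
exact: sem_double.
Qed.

Lemma sem_compl o (b : bool) xs : sem o complP (nat_of_bool b :: xs) (~~ b).
Proof.
have -> : nat_of_bool (~~ b) = 1 - b by case: b.
by apply: (sem_prec (h := fun n => 1 - n)) => [|m]; first exact: (sem_const o 1).
Qed.

Lemma sem_odd o n xs : sem o oddP (n :: xs) (odd n).
Proof.
apply: (sem_prec (h := fun n => odd n)) => // m.
apply: sem_comp1 (sem_proj _ _ _) _; exact: (sem_compl _ (odd m)).
Qed.

(** Passing from [m] to its successor raises the half by [odd m]. *)
Lemma sem_half o n xs : sem o halfP (n :: xs) n./2.
Proof.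
apply: (sem_prec (h := half)) => // m.
apply: (sem_comp2 (y1 := nat_of_bool (odd m)) _ (sem_proj _ _ _) _); last first.
  by have := sem_add o (odd m) m./2 [::]; rewrite -uphalf_half.
by apply: sem_comp1 (sem_proj _ _ _) _; apply: sem_odd.
Qed.

Lemma iter_half_pairc a m : iter a half (pairc a m) = m.*2.+1.
Proof.
rewrite /pairc; elim: a => [|a IHa]; first by rewrite mul1n.
by rewrite iterSr expnS -mulnA mul2n doubleK.
Qed.

Lemma odd_iter_half_pairc a m b :
  b < a -> odd (iter b half (pairc a m)) = false.
Proof.
move=> ltba; rewrite -(subnKC ltba) /pairc; move: (a - b.+1) => k {ltba}.
elim: b => [|b IHb]; first by rewrite add1n expnS -mulnA mul2n /= odd_double.
by rewrite iterSr 2!addSn expnS -mulnA mul2n doubleK -addSn.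
Qed.

Lemma sem_shift o a n xs : sem o shiftP [:: a, n & xs] (iter a half n).
Proof.
apply: (sem_prec (h := fun a => iter a half n)) => // b.
by apply: sem_comp1 (sem_proj _ _ _) _; apply: sem_half.
Qed.

Lemma sem_head o a m xs : sem o headP (pairc a m :: xs) a.
Proof.
set n := pairc a m.
have test b : sem o (Comp (Prec (Proj 0) Zero) [:: Comp oddP [:: shiftP]; Proj 1])
    [:: b, n & xs] (if odd (iter b half n) then 0 else n).
  apply: (sem_comp2 (y1 := nat_of_bool (odd (iter b half n))) _ (sem_proj _ _ _) _).
    by apply: sem_comp1 (sem_shift _ _ _ _) _; apply: sem_odd.
  by case: (odd _) => //; exists n.
split.
  by have := test a; rewrite iter_half_pairc /= odd_double.
(* At a zero bit the test returns [n] itself, which is nonzero; hence the predecessor as witness. *)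
move=> b ltba; exists n.-1; have := test b; rewrite odd_iter_half_pairc // prednK //.
by rewrite muln_gt0 expn_gt0.
Qed.

Lemma sem_tail o a m xs : sem o tailP (pairc a m :: xs) m.
Proof.
apply: (sem_comp1 (y := m.*2.+1) _ _).
  apply: sem_comp2 (sem_head _ _ _ _) (sem_proj _ _ _) _.
  by rewrite -(iter_half_pairc a m); apply: sem_shift.
by rewrite -[m in X in sem _ _ _ X](uphalf_double m); apply: sem_half.
Qed.

(** * Computability on encoded data *)

(* Every functional needed here is total for every oracle, so that it can be
   written as an ordinary function. *)
Definition computable (A B : Type) (eA : A -> nat) (eB : B -> nat)
    (f : cantor -> A -> B) : Prop :=
  exists p, forall o a, sem o p [:: eA a] (eB (f o a)).

Definition enat (n : nat) : nat := n.
Definition ebool (b : bool) : nat := b.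
Definition efin (L : finType) (a : L) : nat := enum_rank a.
Definition eprod (A B : Type) (eA : A -> nat) (eB : B -> nat) (u : A * B) : nat :=
  pairc (eA u.1) (eB u.2).
Definition eseq (A : Type) (eA : A -> nat) (s : seq A) : nat :=
  foldr (fun a m => pairc (eA a) m) 0 s.

Lemma wcodeE (L : finType) (w : seq L) : wcode w = eseq (@efin L) w.
Proof. by rewrite /wcode /CodeSeq.code foldr_map. Qed.

Lemma efin_inj (L : finType) : injective (@efin L).
Proof. by move=> a b /ord_inj /enum_rank_inj. Qed.

(** Lets the code of a sequence serve as the number of iterations of a loop over it. *)
Lemma size_eseq (A : Type) (eA : A -> nat) (s : seq A) : size s <= eseq eA s.
Proof.
elim: s => //= a s IHs; apply: leq_ltn_trans IHs _.
rewrite /pairc -addnn; apply: leq_trans (leq_pmull _ _); last by rewrite expn_gt0.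
by rewrite ltnS leq_addr.
Qed.

Lemma eseq_nat s : eseq enat s = CodeSeq.code s.
Proof. by []. Qed.

Section Combinators.
Variables (G : Type) (eG : G -> nat).

Lemma computable_ext (A : Type) (eA : A -> nat) (f g : cantor -> G -> A) :
  (forall o x, f o x = g o x) -> computable eG eA f -> computable eG eA g.
Proof. by move=> fg [p hp]; exists p => o a; rewrite -fg. Qed.

Lemma computable_const (A : Type) (eA : A -> nat) (a : A) :
  computable eG eA (fun _ _ => a).
Proof. by exists (constP (eA a)) => o x; apply: sem_const. Qed.

Lemma computable_id : computable eG eG (fun _ x => x).
Proof. by exists (Proj 0). Qed.

Lemma computable_comp (A B : Type) (eA : A -> nat) (eB : B -> nat)
    (h : cantor -> A -> B) (f : cantor -> G -> A) :
  computable eA eB h -> computable eG eA f -> computable eG eB (fun o x => h o (f o x)).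
Proof. by move=> [p hp] [q hq]; exists (Comp p [:: q]) => o x; apply: sem_comp1. Qed.

Lemma computable_oracle (f : cantor -> G -> nat) :
  computable eG enat f -> computable eG ebool (fun o x => o (f o x)).
Proof. by move=> [p hp]; exists (Comp Oracle [:: p]) => o x; apply: sem_comp1. Qed.

Lemma computable_prog1 (A : Type) (eA : A -> nat) (p : prog) (f : cantor -> G -> nat)
    (h : cantor -> G -> A) :
  (forall o x, sem o p [:: f o x] (eA (h o x))) ->
  computable eG enat f -> computable eG eA h.
Proof. by move=> hp [q hq]; exists (Comp p [:: q]) => o x; apply: sem_comp1 (hp o x). Qed.

(** Programs given by the hypotheses on the action take two separate arguments, whereas [computable]
    packs its input into one number; this bridges the two. *)
Lemma computable_prog2 (A : Type) (eA : A -> nat) (p : prog)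
    (f1 f2 : cantor -> G -> nat) (h : cantor -> G -> A) :
  (forall o x, sem o p [:: f1 o x; f2 o x] (eA (h o x))) ->
  computable eG enat f1 -> computable eG enat f2 -> computable eG eA h.
Proof.
move=> hp [q1 hq1] [q2 hq2]; exists (Comp p [:: q1; q2]) => o x.
by apply: sem_comp2 (hp o x).
Qed.

Lemma computable_pair (A B : Type) (eA : A -> nat) (eB : B -> nat)
    (f : cantor -> G -> A) (g : cantor -> G -> B) :
  computable eG eA f -> computable eG eB g ->
  computable eG (eprod eA eB) (fun o x => (f o x, g o x)).
Proof.
move=> [p hp] [q hq]; exists (Comp pairP [:: p; q]) => o x.
by apply: sem_comp2 (hp o x) (hq o x) _; apply: sem_pair.
Qed.

Lemma computable_fst (A B : Type) (eA : A -> nat) (eB : B -> nat)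
    (f : cantor -> G -> A * B) :
  computable eG (eprod eA eB) f -> computable eG eA (fun o x => (f o x).1).
Proof.
move=> [p hp]; exists (Comp headP [:: p]) => o x.
by apply: sem_comp1 (hp o x) _; apply: sem_head.
Qed.

Lemma computable_snd (A B : Type) (eA : A -> nat) (eB : B -> nat)
    (f : cantor -> G -> A * B) :
  computable eG (eprod eA eB) f -> computable eG eB (fun o x => (f o x).2).
Proof.
move=> [p hp]; exists (Comp tailP [:: p]) => o x.
by apply: sem_comp1 (hp o x) _; apply: sem_tail.
Qed.

Lemma computable_natrec (A : Type) (eA : A -> nat) (n : cantor -> G -> nat)
    (a : cantor -> G -> A) (g : cantor -> G -> nat -> A -> A) :
  computable eG enat n -> computable eG eA a ->
  computable (eprod eG (eprod enat eA)) eA (fun o u => g o u.1 u.2.1 u.2.2) ->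
  computable eG eA (fun o x => nat_rect _ (a o x) (g o x) (n o x)).
Proof.
move=> [pn hn] [pa ha] [pg hg].
(* Inside [Prec] the arguments are the counter, the previous value and the parameter; they are
   repacked as the code of [(x, (m, t))]. *)
pose step := Comp pg [:: Comp pairP [:: Proj 2; Comp pairP [:: Proj 0; Proj 1]]].
exists (Comp (Prec pa step) [:: pn; Proj 0]) => o x.
apply: sem_comp2 (hn o x) (sem_proj _ _ _) _.
apply: (sem_prec (h := fun n => eA (nat_rect _ (a o x) (g o x) n))) => [|m]; first exact: ha.
set t := nat_rect _ _ _ m; have := hg o (x, (m, t)); apply: sem_comp1.
apply: sem_comp2 (sem_proj _ _ _) _ (sem_pair _ _ _ _).
exact: sem_comp2 (sem_proj _ _ _) (sem_proj _ _ _) (sem_pair _ _ _ _).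
Qed.

Lemma computable_mu (f : cantor -> G -> nat) (P : cantor -> G -> nat -> bool) :
  computable (eprod eG enat) ebool (fun o u => P o u.1 u.2) ->
  (forall o x, P o x (f o x)) -> (forall o x m, m < f o x -> ~~ P o x m) ->
  computable eG enat f.
Proof.
move=> [p hp] Pf Pmin.
(* [Mu] looks for a zero and puts the candidate first, so the test is negated and its arguments
   swapped. *)
pose test := Comp complP [:: Comp p [:: Comp pairP [:: Proj 1; Proj 0]]].
have test_correct o x m : sem o test [:: m; eG x] (~~ P o x m).
  apply: (sem_comp1 (y := nat_of_bool (P o x m))).
    apply: sem_comp1 (hp o (x, m)).
    exact: sem_comp2 (sem_proj _ _ _) (sem_proj _ _ _) (sem_pair _ _ _ _).
  exact: sem_compl.
exists (Mu test) => o x; split.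
  by have := test_correct o x (f o x); rewrite Pf.
by move=> m /Pmin Pm; exists 0; have := test_correct o x m; rewrite Pm.
Qed.

Lemma computable_seqcase (A B : Type) (eA : A -> nat) (eB : B -> nat)
    (s : cantor -> G -> seq A) (a : cantor -> G -> B) (b : cantor -> G -> A -> seq A -> B) :
  computable eG (eseq eA) s -> computable eG eB a ->
  computable (eprod eG (eprod eA (eseq eA))) eB (fun o u => b o u.1 u.2.1 u.2.2) ->
  computable eG eB (fun o x => if s o x is c :: t then b o x c t else a o x).
Proof.
move=> [ps hs] [pa ha] [pb hb].
(* [Prec] serves as a case distinction: the step ignores counter and previous value. It recomputes
   the code of the sequence, which for a nonempty one is already the code of the pair of head and
   tail. *)
pose step := Comp pb [:: Comp pairP [:: Proj 2; Comp ps [:: Proj 2]]].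
exists (Comp (Prec pa step) [:: ps; Proj 0]) => o x.
apply: sem_comp2 (hs o x) (sem_proj _ _ _) _; have := hs o x.
case: (s o x) => [_|c t ht]; first exact: ha.
pose h n := if n is 0 then eB (a o x) else eB (b o x c t).
have -> : eB (b o x c t) = h (pairc (eA c) (eseq eA t)).
  by rewrite /h /pairc; case: (2 ^ _ * _) (muln_gt0 (2 ^ eA c) (eseq eA t).*2.+1);
    rewrite ?expn_gt0.
apply: (sem_prec (h := h)) => [|m]; first exact: ha.
have := hb o (x, (c, t)); apply: sem_comp1.
apply: sem_comp2 (sem_proj _ _ _) _ (sem_pair _ _ _ _).
exact: sem_comp1 (sem_proj _ _ _) _.
Qed.

End Combinators.

Lemma computable_proj1 (A B : Type) (eA : A -> nat) (eB : B -> nat) :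
  computable (eprod eA eB) eA (fun _ u => u.1).
Proof. exact: computable_fst (computable_id _). Qed.

Lemma computable_proj2 (A B : Type) (eA : A -> nat) (eB : B -> nat) :
  computable (eprod eA eB) eB (fun _ u => u.2).
Proof. exact: computable_snd (computable_id _). Qed.

Lemma computable_natcase (G : Type) (eG : G -> nat) (A : Type) (eA : A -> nat)
    (n : cantor -> G -> nat) (a : cantor -> G -> A) (b : cantor -> G -> nat -> A) :
  computable eG enat n -> computable eG eA a ->
  computable (eprod eG enat) eA (fun o u => b o u.1 u.2) ->
  computable eG eA (fun o x => if n o x is m.+1 then b o x m else a o x).
Proof.
move=> hn ha hb; pose g o x m (_ : A) := b o x m.
apply: (@computable_ext _ _ _ _ (fun o x => nat_rect _ (a o x) (g o x) (n o x))).
  by move=> o x; case: (n o x).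
apply: computable_natrec => //.
apply: (computable_comp hb (f := fun _ u => (u.1, u.2.1))).
exact: computable_pair (computable_proj1 _ _) (computable_fst (computable_proj2 _ _)).
Qed.

Lemma computable_if (G : Type) (eG : G -> nat) (A : Type) (eA : A -> nat)
    (c : cantor -> G -> bool) (a b : cantor -> G -> A) :
  computable eG ebool c -> computable eG eA a -> computable eG eA b ->
  computable eG eA (fun o x => if c o x then a o x else b o x).
Proof.
move=> hc ha hb.
apply: (@computable_ext _ _ _ _
  (fun o x => if nat_of_bool (c o x) is _.+1 then a o x else b o x)).
  by move=> o x; case: (c o x).
apply: (computable_natcase (b := fun o x _ => a o x)) => //.
exact: computable_comp ha (computable_proj1 _ _).
Qed.

Lemma computable_negb (G : Type) (eG : G -> nat) (c : cantor -> G -> bool) :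
  computable eG ebool c -> computable eG ebool (fun o x => ~~ c o x).
Proof. by move=> hc; apply: computable_if => //; apply: computable_const. Qed.

Lemma computable_andb (G : Type) (eG : G -> nat) (c d : cantor -> G -> bool) :
  computable eG ebool c -> computable eG ebool d ->
  computable eG ebool (fun o x => c o x && d o x).
Proof. by move=> hc hd; apply: computable_if => //; apply: computable_const. Qed.

Lemma computable_orb (G : Type) (eG : G -> nat) (c d : cantor -> G -> bool) :
  computable eG ebool c -> computable eG ebool d ->
  computable eG ebool (fun o x => c o x || d o x).
Proof. by move=> hc hd; apply: computable_if => //; apply: computable_const. Qed.

Lemma computable_succ (G : Type) (eG : G -> nat) (n : cantor -> G -> nat) :
  computable eG enat n -> computable eG enat (fun o x => (n o x).+1).
Proof. by move=> [p hp]; exists (Comp Succ [:: p]) => o x; apply: sem_comp1 (hp o x) _. Qed.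

Lemma computable_pred (G : Type) (eG : G -> nat) (n : cantor -> G -> nat) :
  computable eG enat n -> computable eG enat (fun o x => (n o x).-1).
Proof.
move=> hn; apply: (computable_natcase (b := fun _ _ m => m)) => //.
exact: computable_proj2.
Qed.

Lemma computable_iszero (G : Type) (eG : G -> nat) (n : cantor -> G -> nat) :
  computable eG enat n -> computable eG ebool (fun o x => n o x == 0).
Proof.
move=> hn; apply: (@computable_ext _ _ _ _
  (fun o x => if n o x is _.+1 then false else true)).
  by move=> o x; case: (n o x).
by apply: (computable_natcase (b := fun _ _ _ => false)) => //; apply: computable_const.
Qed.

Lemma computable_add (G : Type) (eG : G -> nat) (m n : cantor -> G -> nat) :
  computable eG enat m -> computable eG enat n ->
  computable eG enat (fun o x => m o x + n o x).
Proof.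
move=> [p hp] [q hq]; exists (Comp addP [:: p; q]) => o x.
exact: sem_comp2 (hp o x) (hq o x) (sem_add _ _ _ _).
Qed.

Lemma computable_sub (G : Type) (eG : G -> nat) (m n : cantor -> G -> nat) :
  computable eG enat m -> computable eG enat n ->
  computable eG enat (fun o x => m o x - n o x).
Proof.
move=> hm hn.
apply: (@computable_ext _ _ _ _ (fun o x => nat_rect _ (m o x) (fun _ t => t.-1) (n o x))).
  by move=> o x; elim: (n o x) => [|k IHk]; [rewrite subn0 | rewrite subnS -IHk].
apply: (computable_natrec (g := fun _ _ _ t => t.-1)) => //.
exact: computable_pred (computable_snd (computable_proj2 _ _)).
Qed.

Lemma computable_leq (G : Type) (eG : G -> nat) (m n : cantor -> G -> nat) :
  computable eG enat m -> computable eG enat n ->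
  computable eG ebool (fun o x => m o x <= n o x).
Proof. by move=> hm hn; apply: computable_iszero; apply: computable_sub. Qed.

Lemma computable_eqn (G : Type) (eG : G -> nat) (m n : cantor -> G -> nat) :
  computable eG enat m -> computable eG enat n ->
  computable eG ebool (fun o x => m o x == n o x).
Proof.
move=> hm hn.
apply: (@computable_ext _ _ _ _ (fun o x => (m o x <= n o x) && (n o x <= m o x))).
  by move=> o x; rewrite eqn_leq.
by apply: computable_andb; apply: computable_leq.
Qed.

Lemma computable_eq (G : Type) (eG : G -> nat) (A : eqType) (eA : A -> nat)
    (f g : cantor -> G -> A) :
  injective eA -> computable eG eA f -> computable eG eA g ->
  computable eG ebool (fun o x => f o x == g o x).
Proof.
move=> injA hf hg.
apply: (@computable_ext _ _ _ _ (fun o x => eA (f o x) == eA (g o x))).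
  by move=> o x; rewrite (inj_eq injA).
by apply: computable_eqn; [case: hf => p hp; exists p | case: hg => p hp; exists p].
Qed.

(** The hypothesis [exP], for all oracles and inputs, is what keeps an unbounded search total. *)
Lemma computable_search (G : Type) (eG : G -> nat) (P : cantor -> G -> nat -> bool)
    (exP : forall o x, exists n, P o x n) :
  computable (eprod eG enat) ebool (fun o u => P o u.1 u.2) ->
  computable eG enat (fun o x => ex_minn (exP o x)).
Proof.
move=> /computable_mu; apply => o x; first by case: ex_minnP.
by move=> m; case: ex_minnP => n _ min_n; apply: contraL => /min_n; rewrite -leqNgt.
Qed.

Lemma computable_mulc (G : Type) (eG : G -> nat) (m : cantor -> G -> nat) d :
  computable eG enat m -> computable eG enat (fun o x => m o x * d).
Proof.
move=> hm; elim: d => [|d IHd].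
  by apply: (@computable_ext _ _ _ _ (fun _ _ => 0));
    [move=> *; rewrite muln0 | apply: computable_const].
apply: (@computable_ext _ _ _ _ (fun o x => m o x + m o x * d)); last exact: computable_add.
by move=> *; rewrite mulnS.
Qed.

Lemma computable_divc (G : Type) (eG : G -> nat) (m : cantor -> G -> nat) d :
  computable eG enat m -> computable eG enat (fun o x => m o x %/ d.+1).
Proof.
(* The quotient is the least [n] for which [n.+1] times the divisor exceeds the number. *)
move=> hm; apply: (computable_mu (P := fun o x n => m o x < n.+1 * d.+1)).
- apply: computable_leq; last exact: computable_mulc (computable_succ (computable_proj2 _ _)).
  exact: computable_succ (computable_comp hm (computable_proj1 _ _)).
- by move=> o x; rewrite -ltn_divLR.
- by move=> o x n; rewrite -ltn_divLR // -leqNgt.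
Qed.

Lemma computable_modc (G : Type) (eG : G -> nat) (m : cantor -> G -> nat) d :
  computable eG enat m -> computable eG enat (fun o x => m o x %% d.+1).
Proof.
move=> hm; apply: (@computable_ext _ _ _ _ (fun o x => m o x - m o x %/ d.+1 * d.+1)).
  by move=> o x; rewrite {1}(divn_eq (m o x) d.+1) addKn.
by apply: computable_sub => //; exact: computable_mulc (computable_divc _ _).
Qed.

(** The finitely many programs, one for each letter, are built into a single one, so no uniformity
    in the letter is required. *)
Lemma computable_fincase (G : Type) (eG : G -> nat) (L : finType) (A : Type) (eA : A -> nat)
    (f : cantor -> G -> L) (h : cantor -> G -> L -> A) :
  computable eG (@efin L) f -> (forall a, computable eG eA (fun o x => h o x a)) ->
  computable eG eA (fun o x => h o x (f o x)).
Proof.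
(* If [L] is empty then so is the domain, since [f] would yield a letter, and any program will
   do. *)
move=> hf hh; have [a0|L0] := pickP (@predT L); last first.
  by exists Zero => o x; have := L0 (f o x).
move=> _.
apply: (@computable_ext _ _ _ _ (fun o x =>
  foldr (fun a r => if f o x == a then h o x a else r) (h o x a0) (enum L))).
  move=> o x; have : f o x \in enum L by rewrite mem_enum.
  elim: (enum L) => //= a l IHl; rewrite inE; case: eqP => [-> //|_]; exact: IHl.
elim: (enum L) => [|a l IHl] /=; first exact: hh.
apply: computable_if => //.
by apply: (computable_eq (@efin_inj L)) => //; apply: computable_const.
Qed.

Lemma computable_finfun (G : Type) (eG : G -> nat) (L : finType) (A : Type) (eA : A -> nat)
    (f : cantor -> G -> L) (h : L -> A) :
  computable eG (@efin L) f -> computable eG eA (fun o x => h (f o x)).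
Proof.
by move=> hf; apply: (computable_fincase (h := fun _ _ => h)) => // a; apply: computable_const.
Qed.

Lemma computable_all (G : Type) (eG : G -> nat) (T : Type) (l : seq T)
    (P : cantor -> G -> T -> bool) :
  (forall a, computable eG ebool (fun o x => P o x a)) ->
  computable eG ebool (fun o x => all (P o x) l).
Proof.
move=> hP; elim: l => [|a l IHl] /=; first exact: computable_const.
exact: computable_andb.
Qed.

Lemma computable_has (G : Type) (eG : G -> nat) (T : Type) (l : seq T)
    (P : cantor -> G -> T -> bool) :
  (forall a, computable eG ebool (fun o x => P o x a)) ->
  computable eG ebool (fun o x => has (P o x) l).
Proof.
move=> hP; elim: l => [|a l IHl] /=; first exact: computable_const.
exact: computable_orb.
Qed.

Lemma computable_find (G : Type) (eG : G -> nat) (L : finType) (a0 : L) (l : seq L)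
    (P : cantor -> G -> L -> bool) :
  (forall a, computable eG ebool (fun o x => P o x a)) ->
  computable eG (@efin L) (fun o x => nth a0 l (find (P o x) l)).
Proof.
move=> hP; elim: l => [|a l IHl] /=; first exact: computable_const.
apply: (@computable_ext _ _ _ _ (fun o x => if P o x a then a else nth a0 l (find (P o x) l))).
  by move=> o x; case: (P o x a).
by apply: computable_if => //; apply: computable_const.
Qed.

(** A semi-decidable graph suffices when the values form a finite set: search for a stage at which
    some letter is accepted, then look that letter up. Only the correct one is ever accepted. *)
Lemma computable_dovetail (G : Type) (eG : G -> nat) (L : finType) (f : cantor -> G -> L)
    (P : cantor -> G -> L -> nat -> bool) :
  (forall o x a, (exists k, P o x a k) <-> a = f o x) ->
  (forall a, computable (eprod eG enat) ebool (fun o u => P o u.1 a u.2)) ->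
  computable eG (@efin L) f.
Proof.
move=> Pf hP; have [a0|L0] := pickP (@predT L); last first.
  by exists Zero => o x; have := L0 (f o x).
move=> _; pose Q o x k := has (fun a => P o x a k) (enum L).
have exQ o x : exists k, Q o x k.
  have [_ /(_ erefl) [k Pk]] := Pf o x (f o x).
  by exists k; apply/hasP; exists (f o x); rewrite ?mem_enum.
pose K o x := ex_minn (exQ o x).
have hK : computable eG enat K by apply: computable_search; apply: computable_has.
apply: (@computable_ext _ _ _ _ (fun o x =>
  nth a0 (enum L) (find (fun a => P o x a (K o x)) (enum L)))).
  move=> o x; apply/Pf; exists (K o x).
  by have := nth_find a0 (s := enum L) (a := fun a => P o x a (K o x)); apply;
    rewrite /K; case: ex_minnP.
apply: (computable_find a0 (enum L) (P := fun o x a => P o x a (K o x))) => a.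
exact: (computable_comp (hP a) (computable_pair (computable_id _) hK)).
Qed.

(** Dovetailing with an idle stage: the function is recognised among finitely many by comparing its
    finitely many values. *)
Lemma computable_ffun (G : Type) (eG : G -> nat) (L1 L2 : finType)
    (f : cantor -> G -> {ffun L1 -> L2}) :
  (forall s, computable eG (@efin L2) (fun o x => f o x s)) ->
  computable eG (@efin _) f.
Proof.
move=> hf; apply: (computable_dovetail
  (P := fun o x (b : {ffun L1 -> L2}) _ => all (fun s => f o x s == b s) (enum L1))).
  move=> o x b; split=> [[_ /allP h]|->]; last by exists 0; apply/allP.
  by apply/ffunP=> s; apply/esym/eqP/h; rewrite mem_enum.
move=> b; apply: computable_all => s; apply: (computable_eq (@efin_inj L2)).
  exact: computable_comp (hf s) (computable_proj1 _ _).
exact: computable_const.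
Qed.

Lemma computable_nthc (G : Type) (eG : G -> nat) (l : seq bool) (n : cantor -> G -> nat) :
  computable eG enat n -> computable eG ebool (fun o x => nth false l (n o x)).
Proof.
elim: l n => [|b l IHl] n hn.
  by apply: (@computable_ext _ _ _ _ (fun _ _ => false));
    [move=> *; rewrite nth_nil | apply: computable_const].
apply: (@computable_ext _ _ _ _ (fun o x =>
    if n o x == 0 then b else nth false l (n o x).-1)).
  by move=> o x; case: (n o x).
apply: computable_if; [exact: computable_iszero | exact: computable_const |].
exact: IHl (computable_pred _).
Qed.

Lemma computable_nil (G : Type) (eG : G -> nat) (A : Type) (eA : A -> nat) :
  computable eG (eseq eA) (fun _ _ => [::]).
Proof. exact: computable_const. Qed.

Lemma computable_cons (G : Type) (eG : G -> nat) (A : Type) (eA : A -> nat)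
    (a : cantor -> G -> A) (s : cantor -> G -> seq A) :
  computable eG eA a -> computable eG (eseq eA) s ->
  computable eG (eseq eA) (fun o x => a o x :: s o x).
Proof. exact: computable_pair. Qed.

Lemma computable_behead (G : Type) (eG : G -> nat) (A : Type) (eA : A -> nat)
    (s : cantor -> G -> seq A) :
  computable eG (eseq eA) s -> computable eG (eseq eA) (fun o x => behead (s o x)).
Proof.
move=> hs; apply: (computable_seqcase (b := fun _ _ _ t => t)) hs _ _.
  exact: computable_nil.
exact: computable_snd (computable_proj2 _ _).
Qed.

Lemma computable_nth (G : Type) (eG : G -> nat) (s : cantor -> G -> seq nat) i :
  computable eG (eseq enat) s -> computable eG enat (fun o x => nth 0 (s o x) i).
Proof.
elim: i s => [|i IHi] s hs.
  apply: (@computable_ext _ _ _ _ (fun o x => if s o x is c :: _ then c else 0)).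
    by move=> o x; case: (s o x).
  apply: (computable_seqcase (b := fun _ _ c _ => c)) hs (computable_const _ _ _) _.
  exact: computable_fst (computable_proj2 _ _).
apply: (@computable_ext _ _ _ _ (fun o x => nth 0 (behead (s o x)) i)).
  by move=> o x; rewrite nth_behead.
exact: IHi (computable_behead _).
Qed.

Lemma computable_foldl (G : Type) (eG : G -> nat) (A B : Type) (eA : A -> nat)
    (eB : B -> nat) (s : cantor -> G -> seq A) (z : cantor -> G -> B)
    (g : cantor -> G -> B -> A -> B) :
  computable (eprod eG (eprod eB eA)) eB (fun o u => g o u.1 u.2.1 u.2.2) ->
  computable eG eB z -> computable eG (eseq eA) s ->
  computable eG eB (fun o x => foldl (g o x) (z o x) (s o x)).
Proof.
move=> hg hz hs.
(* The state is the accumulator with the part still to be read. Once that part is empty the state is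
   fixed, so iterating more often than the length, as the code prescribes, does no harm. *)
pose step o x (_ : nat) (st : B * seq A) :=
  if st.2 is c :: t then (g o x st.1 c, t) else st.
apply: (@computable_ext _ _ _ _ (fun o x =>
  (nat_rect (fun=> B * seq A)%type (z o x, s o x) (step o x) (eseq eA (s o x))).1)).
  move=> o x; rewrite -[RHS]/((foldl (g o x) (z o x) (s o x), [::] : seq A).1).
  congr fst; have := size_eseq eA (s o x); move: (eseq _ _) => n.
  elim: (s o x) (z o x) n {hz hs} => [|c t IHt] z0 n.
    by move=> _; elim: n => //= n ->.
  case: n => // n /IHt <-; elim: n {IHt} => // n IHn.
  by rewrite /= in IHn *; rewrite -IHn.
apply: (@computable_fst _ _ _ _ _ (eseq eA)).
apply: (computable_natrec (n := fun o x => eseq eA (s o x))) => //.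
  exact: computable_pair.
apply: (computable_seqcase (s := fun o u => u.2.2.2)
   (b := fun o u c t => (g o u.1 u.2.2.1 c, t))).
- exact: computable_snd (computable_snd (computable_proj2 _ _)).
- exact: computable_snd (computable_proj2 _ _).
- apply: computable_pair; last exact: computable_snd (computable_proj2 _ _).
  apply: (computable_comp hg (f := fun _ u => (u.1.1, (u.1.2.2.1, u.2.1)))).
  apply: computable_pair; first exact: computable_fst (computable_proj1 _ _).
  apply: computable_pair; last exact: computable_fst (computable_proj2 _ _).
  exact: computable_fst (computable_snd (computable_snd (computable_proj1 _ _))).
Qed.

Lemma computable_catrev (G : Type) (eG : G -> nat) (A : Type) (eA : A -> nat)
    (s t : cantor -> G -> seq A) :
  computable eG (eseq eA) s -> computable eG (eseq eA) t ->
  computable eG (eseq eA) (fun o x => catrev (s o x) (t o x)).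
Proof.
move=> hs ht; apply: (@computable_ext _ _ _ _
    (fun o x => foldl (fun acc c => c :: acc) (t o x) (s o x))).
  by move=> o x; elim: (s o x) (t o x) => //= c l IHl w; rewrite IHl.
apply: (computable_foldl (eA := eA) (g := fun _ _ acc c => c :: acc)) => //.
apply: computable_cons; first exact: computable_snd (computable_proj2 _ _).
exact: computable_fst (computable_proj2 _ _).
Qed.

Lemma computable_rev (G : Type) (eG : G -> nat) (A : Type) (eA : A -> nat)
    (s : cantor -> G -> seq A) :
  computable eG (eseq eA) s -> computable eG (eseq eA) (fun o x => rev (s o x)).
Proof. by move=> hs; apply: computable_catrev => //; apply: computable_nil. Qed.

Lemma computable_cat (G : Type) (eG : G -> nat) (A : Type) (eA : A -> nat)
    (s t : cantor -> G -> seq A) :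
  computable eG (eseq eA) s -> computable eG (eseq eA) t ->
  computable eG (eseq eA) (fun o x => s o x ++ t o x).
Proof.
move=> hs ht; apply: (@computable_ext _ _ _ _ (fun o x => catrev (rev (s o x)) (t o x))).
  by move=> o x; rewrite catrevE revK.
exact: computable_catrev (computable_rev hs) ht.
Qed.

Lemma computable_foldr (G : Type) (eG : G -> nat) (A B : Type) (eA : A -> nat)
    (eB : B -> nat) (s : cantor -> G -> seq A) (z : cantor -> G -> B)
    (g : cantor -> G -> A -> B -> B) :
  computable (eprod eG (eprod eB eA)) eB (fun o u => g o u.1 u.2.2 u.2.1) ->
  computable eG eB z -> computable eG (eseq eA) s ->
  computable eG eB (fun o x => foldr (g o x) (z o x) (s o x)).
Proof.
move=> hg hz hs.
apply: (@computable_ext _ _ _ _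
    (fun o x => foldl (fun b a => g o x a b) (z o x) (rev (s o x)))).
  by move=> o x; rewrite foldl_rev.
exact: (computable_foldl (g := fun o x b a => g o x a b)) hg hz (computable_rev hs).
Qed.

(** The table is an arbitrary function on a finite alphabet; this is how words are rewritten from
    one generating set to another. *)
Lemma computable_flatmap (G : Type) (eG : G -> nat) (L : finType) (A : Type)
    (eA : A -> nat) (tab : L -> seq A) (s : cantor -> G -> seq L) :
  computable eG (eseq (@efin L)) s ->
  computable eG (eseq eA) (fun o x => flatten (map tab (s o x))).
Proof.
move=> hs.
apply: (@computable_ext _ _ _ _ (fun o x => foldr (fun a w => tab a ++ w) [::] (s o x))).
  by move=> o x; elim: (s o x) => //= a l ->.
apply: (computable_foldr (g := fun _ _ a w => tab a ++ w)) (computable_nil _ _) hs.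
apply: computable_cat; last exact: computable_fst (computable_proj2 _ _).
exact: computable_finfun (computable_snd (computable_proj2 _ _)).
Qed.

Definition decode_letter (L : finType) (k : nat) (w : seq L) : seq L :=
  foldr (fun a r => if efin a == k then a :: w else r) w (enum L).

(* Numbers that are not the rank of a letter are skipped, so that every number
   denotes a word. *)
Definition decode_word (L : finType) (n : nat) : seq L :=
  foldr (@decode_letter L) [::] (CodeSeq.decode n).

Lemma eseqK (L : finType) (w : seq L) : decode_word L (eseq (@efin L) w) = w.
Proof.
rewrite -wcodeE /decode_word /wcode CodeSeq.codeK.
elim: w => //= a w ->; rewrite /decode_letter.
have : a \in enum L by rewrite mem_enum.
elim: (enum L) => //= b l IHl; rewrite inE eq_sym.
rewrite -[_ == _ :> nat]/(efin b == efin a) (inj_eq (@efin_inj L)).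
by case: (b =P a) => [-> //|_] /IHl.
Qed.

Lemma computable_decode_word (L : finType) :
  computable enat (eseq (@efin L)) (fun _ n => decode_word L n).
Proof.
apply: (computable_foldr (eA := enat) (s := fun _ n => CodeSeq.decode n)
  (g := fun _ _ k w => decode_letter k w)) (computable_nil _ _) _; last first.
  (* Every number is the code of its own decoding, so on codes [CodeSeq.decode] is the identity. *)
  by exists (Proj 0) => o n; rewrite eseq_nat CodeSeq.decodeK.
rewrite /decode_letter; elim: (enum L) => [|a l IHl] /=.
  exact: computable_fst (computable_proj2 _ _).
apply: computable_if => //.
  apply: computable_eqn; first exact: computable_const.
  exact: computable_snd (computable_proj2 _ _).
apply: computable_cons; first exact: computable_const.
exact: computable_fst (computable_proj2 _ _).
Qed.

(** * Enumerations and oracle substitution *)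

(* [eval p k xs] is [y.+1] if [p] returns [y] on [xs] with every unbounded search
   cut off at [k], and 0 if it fails to return. *)
Fixpoint eval (p : prog) (k : nat) (xs : seq nat) : nat :=
  match p with
  | Zero => 1
  | Succ => (nth 0 xs 0).+2
  | Proj i => (nth 0 xs i).+1
  | Oracle => 1
  | Comp f gs =>
      let r := foldr (fun g r => ((eval g k xs != 0) && r.1, (eval g k xs).-1 :: r.2))
                 (true, [::]) gs in
      if r.1 then eval f k r.2 else 0
  | Prec f g =>
      nat_rect (fun=> nat) (eval f k (behead xs))
        (fun n t => if t is t'.+1 then eval g k [:: n, t' & behead xs] else 0)
        (nth 0 xs 0)
  | Mu f =>
      (* 0: no zero nor failure so far; 1: failure; n.+2: first zero at n *)
      (nat_rect (fun=> nat) 0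
        (fun n t => if t is t'.+1 then t else
           if eval f k (n :: xs) is v.+1 then (if v is _.+1 then 0 else n.+2) else 1)
        k).-1
  end.

(** As [p] is fixed, induction on its syntax produces a separate program for each [p] and takes the
    place of a universal machine. *)
Lemma computable_eval p :
  computable (eprod enat (eseq enat)) enat (fun _ u => eval p u.1 u.2).
Proof.
elim/prog_nested_ind: p => [||i||f gs IHf IHgs|f g IHf IHg|f IHf] /=.
- exact: computable_const.
- exact: computable_succ (computable_succ (computable_nth _ (computable_proj2 _ _))).
- exact: computable_succ (computable_nth _ (computable_proj2 _ _)).
- exact: computable_const.
- have hr : computable (eprod enat (eseq enat)) (eprod ebool (eseq enat)) (fun _ u =>
      foldr (fun g r => ((eval g u.1 u.2 != 0) && r.1, (eval g u.1 u.2).-1 :: r.2))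
        (true, [::]) gs).
    elim: gs IHgs => [_|g gs IH IHgs] /=; first exact: computable_const.
    have {}IH := IH (fun g' hg' => IHgs g' (or_intror hg')).
    have hg := IHgs g (or_introl erefl).
    apply: computable_pair.
      apply: computable_andb; last exact: computable_fst IH.
      exact: computable_negb (computable_iszero hg).
    exact: computable_cons (computable_pred hg) (computable_snd IH).
  apply: computable_if; [exact: computable_fst hr | | exact: computable_const].
  exact: (computable_comp IHf (computable_pair (computable_proj1 _ _) (computable_snd hr))).
- have hxs : computable (eprod enat (eseq enat)) (eseq enat) (fun _ u => behead u.2).
    exact: computable_behead (computable_proj2 _ _).
  apply: (computable_natrec (n := fun _ u => nth 0 u.2 0)
    (g := fun _ u n t => if t is t'.+1 then eval g u.1 [:: n, t' & behead u.2] else 0)).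
  + exact: computable_nth (computable_proj2 _ _).
  + exact: (computable_comp IHf (computable_pair (computable_proj1 _ _) hxs)).
  apply: (computable_natcase (n := fun _ u => u.2.2)
    (b := fun _ u t => eval g u.1.1 [:: u.2.1, t & behead u.1.2])).
  + exact: computable_snd (computable_proj2 _ _).
  + exact: computable_const.
  apply: (computable_comp IHg
    (f := fun _ u => (u.1.1.1, [:: u.1.2.1, u.2 & behead u.1.1.2]))).
  apply: computable_pair; first exact: computable_fst (computable_fst (computable_proj1 _ _)).
  apply: computable_cons; first exact: computable_fst (computable_snd (computable_proj1 _ _)).
  apply: computable_cons; first exact: computable_proj2.
  exact: (computable_comp hxs (computable_fst (computable_proj1 _ _))).
- apply: computable_pred.
  apply: (computable_natrec (n := fun _ u => u.1) (a := fun _ _ => 0)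
    (g := fun _ u n t => if t is t'.+1 then t else
       if eval f u.1 (n :: u.2) is v.+1 then (if v is _.+1 then 0 else n.+2) else 1)).
  + exact: computable_proj1.
  + exact: computable_const.
  have hn : computable (eprod (eprod enat (eseq enat)) (eprod enat enat)) enat
      (fun _ u => u.2.1) by exact: computable_fst (computable_proj2 _ _).
  apply: (computable_natcase (n := fun _ u => u.2.2) (b := fun _ u t => u.2.2)).
  + exact: computable_snd (computable_proj2 _ _).
  + apply: (computable_natcase (n := fun _ u => eval f u.1.1 (u.2.1 :: u.1.2))
      (b := fun _ u v => if v is _.+1 then 0 else u.2.1.+2)).
    * apply: (computable_comp IHf (f := fun _ u => (u.1.1, u.2.1 :: u.1.2))).
      apply: computable_pair; first exact: computable_fst (computable_proj1 _ _).
      by apply: computable_cons => //; exact: computable_snd (computable_proj1 _ _).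
    * exact: computable_const.
    apply: (computable_natcase (n := fun _ u => u.2) (b := fun _ _ _ => 0)).
    * exact: computable_proj2.
    * exact: computable_succ (computable_succ (computable_comp hn (computable_proj1 _ _))).
    * exact: computable_const.
  exact: computable_snd (computable_snd (computable_proj1 _ _)).
Qed.

Lemma eval_sound p k xs y : eval p k xs = y.+1 -> run p xs y.
Proof.
rewrite /run.
elim/prog_nested_ind: p xs y => [||i||f gs IHf IHgs|f g IHf IHg|f IHf] xs y /=.
- by case.
- by case.
- by case.
- by case.
- set r := foldr _ _ _; have hr : r.1 -> sems (fun=> false) xs gs r.2.
    rewrite {}/r; elim: gs IHgs => //= g gs IH IHgs.
    case E : (eval g k xs) => [|v] //= /IH h; split; first exact: IHgs (or_introl erefl) _ _ E.
    by apply: h => g' hg'; apply: IHgs; right.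
  by case: (r.1) hr => // /(_ isT) hr /IHf h; exists r.2.
- rewrite semPrec; elim: (nth 0 xs 0) y => [|n IHn] y /=; first exact: IHf.
  case: (nat_rect _ _ _ n) IHn => // t /(_ _ erefl) ht /IHg hg.
  by exists t.
- set F := nat_rect _ _ _.
  (* The invariant follows the three states of the accumulator. Nothing is claimed after a failure,
     since that state makes [eval] return 0. *)
  have inv j : match F j with
      | 0 => forall m, m < j -> exists v, sem (fun=> false) f (m :: xs) v.+1
      | 1 => True
      | n.+2 => sem (fun=> false) (Mu f) xs n
    end.
    elim: j => [|j IHj] //=; rewrite -/(F j); case: (F j) IHj => // IHj.
    case E : (eval f k (j :: xs)) => [|[|v]] //; last first.
      move=> m; rewrite ltnS leq_eqVlt => /predU1P[->|/IHj //].
      by exists v; apply: IHf.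
    by split; [apply: IHf | exact: IHj].
  by move: (inv k); case: (F k) => [|[|n]] //= h [<-].
Qed.

(** Asking for all large cut-offs lets finitely many subcomputations share one, with no separate
    proof that [eval] is monotone in the cut-off. *)
Definition eventually (P : nat -> Prop) := exists k0, forall k, k0 <= k -> P k.

Lemma eventually_and (P Q : nat -> Prop) :
  eventually P -> eventually Q -> eventually (fun k => P k /\ Q k).
Proof.
move=> [m hm] [n hn]; exists (maxn m n) => k; rewrite geq_max => /andP[lmk lnk].
by split; [exact: hm | exact: hn].
Qed.

Lemma eventually_mono (P Q : nat -> Prop) :
  (forall k, P k -> Q k) -> eventually P -> eventually Q.
Proof. by move=> PQ [n hn]; exists n => k /hn /PQ. Qed.

Lemma eval_complete p xs y : run p xs y -> eventually (fun k => eval p k xs = y.+1).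
Proof.
rewrite /run.
elim/prog_nested_ind: p xs y => [||i||f gs IHf IHgs|f g IHf IHg|f IHf] xs y.
- by move=> ->; exists 0.
- by move=> ->; exists 0.
- by move=> ->; exists 0.
- by move=> ->; exists 0.
- rewrite semComp => -[ys hys /IHf hf].
  have : eventually (fun k => foldr (fun g r =>
      ((eval g k xs != 0) && r.1, (eval g k xs).-1 :: r.2)) (true, [::]) gs = (true, ys)).
    elim: gs ys IHgs hys {hf} => [|g gs IH] [|z ys] IHgs //=; first by exists 0.
    case=> /(IHgs g (or_introl erefl)) hg hgs.
    have {}IH := IH _ (fun g' hg' => IHgs g' (or_intror hg')) hgs.
    by apply: eventually_mono (eventually_and hg IH) => k [-> ->].
  by move=> h; apply: eventually_mono (eventually_and hf h) => k [hk /= ->].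
- rewrite semPrec /=; elim: (nth 0 xs 0) y => [|n IHn] y /=; first exact: IHf.
  case=> t /IHn ht /IHg hg.
  by apply: eventually_mono (eventually_and ht hg) => k [-> ->].
- case=> /IHf h0 hlt.
  have : eventually (fun k => forall m, m < y -> exists v, eval f k (m :: xs) = v.+2).
    elim: (y) hlt => [|n IHn] hlt; first by exists 0.
    have [v /IHf hv] := hlt n (ltnSn n).
    have hn := IHn (fun m lt_mn => hlt m (ltnW lt_mn)).
    apply: eventually_mono (eventually_and hn hv) => k [hk hkn] m.
    by rewrite ltnS leq_eqVlt => /predU1P[->|/hk //]; exists v.
  (* The bounded search tries only candidates below [k], so [k] must exceed [y] for the zero to be
     seen. *)
  have hy : eventually (fun k => y < k) by exists y.+1.
  move=> h.
  apply: eventually_mono (eventually_and hy (eventually_and h0 h)) => k [lt_yk [hk0 hk]] /=.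
  set F := nat_rect _ _ _.
  have Flt j : j <= y -> F j = 0.
    elim: j => [|j IHj] //= lt_jy; rewrite -/(F j) IHj 1?ltnW //.
    by have [v ->] := hk j lt_jy.
  have FS n t : F n = t.+1 -> F n.+1 = t.+1 by move=> Fn; rewrite /F /= -/(F n) Fn.
  suff -> : F k = y.+2 by [].
  rewrite -(subnKC lt_yk); elim: (k - _) => [|j IHj].
    by rewrite addn0 /= -/(F y) Flt // hk0.
  by rewrite addnS; apply: FS.
Qed.

Lemma halts_eval p xs : (exists y, run p xs y) <-> exists k, eval p k xs != 0.
Proof.
split=> [[y /eval_complete[k hk]]|[k]]; first by exists k; rewrite hk.
by case E : (eval p k xs) => [|y] // _; exists y; apply: eval_sound E.
Qed.

(** The stage [k] turns a semi-decision into a decidable relation, which can be used inside total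
    searches. *)
Lemma re_words_enumeration (L : finType) (W : set (seq L)) :
  re_words W ->
  exists2 P : nat -> seq L -> bool,
    (forall w, (exists k, P k w) <-> W w) &
    computable (eprod enat (eseq (@efin L))) ebool (fun _ u => P u.1 u.2).
Proof.
case=> p hp; exists (fun k w => eval p k [:: wcode w] != 0).
  by move=> w; rewrite -halts_eval hp.
apply: computable_negb; apply: computable_iszero.
apply: (computable_comp (computable_eval p) (f := fun _ u => (u.1, [:: wcode u.2]))).
apply: computable_pair; first exact: computable_proj1.
apply: computable_cons (computable_nil _ _).
have [q hq] := computable_proj2 enat (eseq (@efin L)).
by exists q => o u; rewrite wcodeE; apply: hq.
Qed.

(** * Composition of functionals and the Medvedev order *)

Fixpoint subst (q p : prog) : prog :=
  match p with
  | Oracle => Comp q [:: Proj 0]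
  | Comp f gs => Comp (subst q f) (map (subst q) gs)
  | Prec f g => Prec (subst q f) (subst q g)
  | Mu f => Mu (subst q f)
  | _ => p
  end.

Lemma sem_subst q p x y xs v :
  functional q x y -> sem y p xs v -> sem x (subst q p) xs v.
Proof.
move=> hq.
elim/prog_nested_ind: p xs v => [||i||f gs IHf IHgs|f g IHf IHg|f IHf] xs v //.
- by move=> ->; apply: sem_comp1 (sem_proj _ _ _) _; apply: hq.
- rewrite /= !semComp => -[ys hys /IHf hf]; exists ys => //.
  elim: gs ys IHgs hys {hf} => [|g gs IH] [|z ys] IHgs //= [hg hgs].
  split; first by apply: IHgs hg; left.
  by apply: IH hgs => g' hg'; apply: IHgs; right.
- rewrite /= !semPrec; elim: (nth 0 xs 0) v => [|n IHn] v /=; first exact: IHf.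
  by case=> t /IHn ht /IHg hg; exists t.
- case=> /IHf h0 hlt; split=> // m /hlt[k /IHf hk]; by exists k.
Qed.

Lemma medvedev_le_refl (P : set cantor) : medvedev_le P P.
Proof. by exists Oracle => x Px; exists x => // n. Qed.

Lemma medvedev_le_trans (P Q R : set cantor) :
  medvedev_le P Q -> medvedev_le Q R -> medvedev_le P R.
Proof.
case=> p hp [q hq]; exists (subst q p) => x /hq[y hy /hp[z hz Pz]].
by exists z => // n; apply: sem_subst hy _.
Qed.

Lemma mdegree_eq (P Q : set cantor) : medvedev_eq P Q -> mdegree P = mdegree Q.
Proof.
move=> [PQ QP]; apply/seteqP; split=> R [] h1 h2; split.
- exact: medvedev_le_trans QP h1.
- exact: medvedev_le_trans h2 PQ.
- exact: medvedev_le_trans PQ h1.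
- exact: medvedev_le_trans h2 QP.
Qed.

Lemma medvedev_eq_refl (P : set cantor) : medvedev_eq P P.
Proof. by split; apply: medvedev_le_refl. Qed.

Lemma mjoin_le (P Q R : set cantor) :
  medvedev_le P R -> medvedev_le Q R -> medvedev_le (mjoin P Q) R.
Proof.
case=> p hp [q hq].
(* [Prec] on the parity acts as a conditional: at 0 it returns the first parameter, and at 1 its
   step picks the second, which sits at position 3 behind the counter and the previous value. *)
pose select := Comp (Prec (Proj 0) (Proj 3)) [:: Comp oddP [:: Proj 0];
  Comp p [:: Comp halfP [:: Proj 0]]; Comp q [:: Comp halfP [:: Proj 0]]].
exists select => x Rx; have [y hy Py] := hp x Rx; have [z hz Qz] := hq x Rx.
exists (interleave y z); last by exists y, z.
move=> n; rewrite /select semComp.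
exists [:: nat_of_bool (odd n); nat_of_bool (y n./2); nat_of_bool (z n./2)].
  have hn : sem x (Comp halfP [:: Proj 0]) [:: n] n./2.
    by apply: sem_comp1 (sem_proj _ _ _) _; apply: sem_half.
  split; first by apply: sem_comp1 (sem_proj _ _ _) _; apply: sem_odd.
  by split; [exact: sem_comp1 hn _ | split=> //; exact: sem_comp1 hn _].
rewrite semPrec /interleave /=; case: (odd n) => //=.
by exists (nat_of_bool (y n./2)).
Qed.

(* Hypotheses about computable maps are stated for the zero oracle; the program
   can be run with any oracle. *)
Lemma sem_run p xs v o : run p xs v -> sem o (subst Zero p) xs v.
Proof. by apply: sem_subst. Qed.

Local Open Scope group_scope.

(** * Codings *)

Section Cancellation.
Variables (L : finType) (cancel : rel L).
Local Notation eL := (@efin L).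

(** With [inverse_letters] for [cancel], one step of free reduction: a letter put before a reduced
    word can cancel only against its first letter, and the remaining tail is still reduced. *)
Definition push_letter (a : L) (w : seq L) : seq L :=
  if w is b :: t then if cancel a b then t else [:: a, b & t] else [:: a].

Lemma computable_push_letter :
  computable (eprod eL (eseq eL)) (eseq eL) (fun _ u => push_letter u.1 u.2).
Proof.
pose eU := eprod (eprod eL (eseq eL)) (eprod eL (eseq eL)).
have ha : computable eU eL (fun _ u => u.1.1) by exact: computable_fst (computable_proj1 _ _).
have hb : computable eU eL (fun _ u => u.2.1) by exact: computable_fst (computable_proj2 _ _).
have ht : computable eU (eseq eL) (fun _ u => u.2.2).
  exact: computable_snd (computable_proj2 _ _).
apply: (computable_seqcase (eA := eL) (s := fun _ u => u.2)
  (b := fun _ u b t => if cancel u.1 b then t else [:: u.1, b & t])).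
- exact: computable_proj2.
- exact: computable_cons (computable_proj1 _ _) (computable_nil _ _).
- apply: computable_if => //; last exact: computable_cons ha (computable_cons hb ht).
  apply: (computable_fincase (h := fun _ u b => cancel u.1.1 b) hb) => b.
  exact: (computable_finfun ebool (fun a => cancel a b) ha).
Qed.

Lemma computable_push_letters :
  computable (eseq eL) (eseq eL) (fun _ w => foldr push_letter [::] w).
Proof.
apply: (computable_foldr (eA := eL) (g := fun _ _ => push_letter));
  [|exact: computable_nil|exact: computable_id].
apply: (computable_comp computable_push_letter (f := fun _ u => (u.2.2, u.2.1))).
apply: computable_pair; first exact: computable_snd (computable_proj2 _ _).
exact: computable_fst (computable_proj2 _ _).
Qed.

End Cancellation.

Definition letters (G : groupType) (R : {fset G}) : finType := (R * bool)%type.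

Section FreeReduction.
Variables (G : groupType) (R : {fset G}).
Implicit Types (a b : R * bool) (w : seq (R * bool)).

Definition inverse_letters a b : bool := (a.1 == b.1) && (a.2 != b.2).

Definition free_reduce w : seq (R * bool) :=
  foldr (@push_letter (letters R) inverse_letters) [::] w.

Lemma computable_free_reduce :
  computable (eseq (@efin (letters R))) (eseq (@efin (letters R)))
    (fun _ w => free_reduce w).
Proof. exact: computable_push_letters. Qed.

Lemma reduced_free_reduce w : reduced (free_reduce w).
Proof.
elim: w => //= a w; case: (free_reduce w) => //= b t; rewrite /reduced /= => pt.
by rewrite /inverse_letters; case: ifP => [_|/= -> //]; apply: path_sorted pt.
Qed.

Lemma swval_cons a w : swval (a :: w) = letter a * swval w.
Proof. by rewrite /swval big_cons. Qed.

Lemma swval_cat w1 w2 : swval (w1 ++ w2) = swval w1 * swval w2.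
Proof. by rewrite /swval big_cat. Qed.

Lemma swval_free_reduce w : swval (free_reduce w) = swval w.
Proof.
elim: w => //= a w IHw; rewrite swval_cons -IHw; case: (free_reduce w) => [|b t] /=.
  by rewrite swval_cons.
rewrite /inverse_letters; case: ifP => [/andP[/eqP ab1 ab2]|_]; last by rewrite swval_cons.
rewrite swval_cons mulgA /letter ab1.
by case: a.2 b.2 ab2 => [] [] //= _; rewrite ?mulVg ?mulgV mul1g.
Qed.

Lemma swval_flatmap (T : Type) (tab : T -> seq (R * bool)) (v : T -> G) (s : seq T) :
  (forall t, swval (tab t) = v t) -> swval (flatten (map tab s)) = \prod_(t <- s) v t.
Proof.
move=> tabv; elim: s => [|a s IHs] /=; first by rewrite /swval !big_nil.
by rewrite swval_cat tabv IHs big_cons.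
Qed.

Lemma wval_cons (r : R) (w : seq R) : wval (r :: w) = fsval r * wval w.
Proof. by rewrite /wval big_cons. Qed.

Lemma wval_cat (w1 w2 : seq R) : wval (w1 ++ w2) = wval w1 * wval w2.
Proof. by rewrite /wval big_cat. Qed.

Lemma wval_flatmap (T : Type) (tab : T -> seq R) (v : T -> G) (s : seq T) :
  (forall t, wval (tab t) = v t) -> wval (flatten (map tab s)) = \prod_(t <- s) v t.
Proof.
move=> tabv; elim: s => [|a s IHs] /=; first by rewrite /wval !big_nil.
by rewrite wval_cat tabv IHs big_cons.
Qed.

Lemma swval_tabulate (T : Type) (v : T -> G) :
  generates R -> exists tab : T -> seq (R * bool), forall t, swval (tab t) = v t.
Proof. by move=> genR; have [tab tabv] := choice (fun t => genR (v t)); exists tab. Qed.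

Lemma wval_surj : generates R -> symmetric_set R -> forall g, exists w : seq R, wval w = g.
Proof.
move=> genR symR g; have [w <-] := genR g.
elim: w => [|a w [u uw]]; first by exists [::]; rewrite /wval /swval !big_nil.
have [r ra] : exists r : R, fsval r = letter a.
  rewrite /letter; case: a.2; last by exists a.1.
  by have rR := symR _ (fsvalP a.1); exists [` rR]%fset.
by exists (r :: u); rewrite wval_cons swval_cons ra uw.
Qed.

Lemma wval_tabulate (T : Type) (v : T -> G) :
  generates R -> symmetric_set R ->
  exists tab : T -> seq R, forall t, wval (tab t) = v t.
Proof.
move=> genR symR; have [tab tabv] := choice (fun t => wval_surj genR symR (v t)).
by exists tab.
Qed.

End FreeReduction.

Section Reading.
Variables (G : groupType) (A : finType) (c : coding G A).

Local Notation letters := (letters (gens c)).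

Definition reduced_word (w : seq letters) : freegrp (gens c) :=
  exist _ (free_reduce w) (reduced_free_reduce w).

Lemma index_exists (w : seq letters) :
  exists n, wcode (sval (enumF c n)) == wcode (free_reduce w).
Proof.
have [e _ eK] := enumF_bij c.
by exists (e (reduced_word w)); rewrite eK.
Qed.

(** A coding provides a program for [enumF] but none for its inverse; the inverse is computed by a
    search, which succeeds by bijectivity. *)
Definition word_index (w : seq letters) : nat := ex_minn (index_exists w).

Lemma wcode_inj (L : finType) : injective (@wcode L).
Proof. by move=> u v; rewrite !wcodeE => /(can_inj (@eseqK L)). Qed.

Lemma enumF_word_index (w : seq letters) : enumF c (word_index w) = reduced_word w.
Proof.
apply: val_inj; rewrite /word_index; case: ex_minnP => n /eqP h _.
exact: wcode_inj h.
Qed.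

Lemma computable_enumF :
  computable enat (eseq (@efin _)) (fun _ n => sval (enumF c n) : seq letters).
Proof.
have [p hp] := enumF_computable c.
apply: (computable_prog1 (p := subst Zero p)) (computable_id _) => o n.
by rewrite -wcodeE; apply: sem_run.
Qed.

Lemma computable_word_index :
  computable (eseq (@efin _)) enat (fun _ w => word_index w).
Proof.
apply: (computable_search (fun _ => index_exists)
  (P := fun _ w n => wcode (sval (enumF c n)) == wcode (free_reduce w))).
apply: (@computable_ext _ _ _ _ (fun _ u =>
    eseq (@efin letters) (sval (enumF c u.2)) == eseq (@efin letters) (free_reduce u.1))).
  by move=> o u; rewrite !wcodeE.
apply: computable_eqn.
  have [p hp] := computable_comp computable_enumF (computable_proj2 (eseq (@efin letters)) enat).
  by exists p.
have [p hp] := computable_comp (@computable_free_reduce _ (gens c))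
  (computable_proj1 (eseq (@efin letters)) enat).
by exists p.
Qed.

(** The default [a0] is returned when the block of the oracle is no code word, as may happen for
    oracles that encode no configuration. *)
Definition read (a0 : A) (o : cantor) (w : seq letters) : A :=
  nth a0 (enum A) (find (fun a => all (fun j =>
    o (word_index w * (len c).+1 + j)%N == nth false (bits c a) j) (iota 0 (len c).+1))
    (enum A)).

Lemma read_encode a0 (x : G -> A) (w : seq letters) :
  read a0 (encode (x \o @rho G (gens c))) w = x (swval w).
Proof.
set a := x (swval w).
have za : (x \o @rho G (gens c)) (enumF c (word_index w)) = a.
  by rewrite enumF_word_index /= /rho /= swval_free_reduce.
rewrite /read (@eq_find _ _ (pred1 a)); first by rewrite -/(index a _) nth_index ?mem_enum.
move=> b; rewrite [RHS]/=.
transitivity (bits c a == bits c b); last by rewrite (inj_eq (@bits_inj _ _ c)) eq_sym.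
  apply/allP/eqP => [h|ab j].
    apply: val_inj; apply: (@eq_from_nth _ false); rewrite ?size_tuple // => j lt_j.
    have /h/eqP <- : j \in iota 0 (len c).+1 by rewrite mem_iota.
    by rewrite /encode divnMDl // divn_small // addn0 modnMDl modn_small // za.
  rewrite mem_iota => /andP[_ lt_j].
  by rewrite /encode divnMDl // divn_small // addn0 modnMDl modn_small // za ab.
Qed.

Lemma computable_read a0 :
  computable (eseq (@efin _)) (@efin A) (read a0).
Proof.
apply: (computable_find a0 (enum A) (P := fun o w a => all (fun j =>
    o (word_index w * (len c).+1 + j)%N == nth false (bits c a) j) (iota 0 (len c).+1))).
move=> a; apply: (computable_all (iota 0 (len c).+1) (P := fun o w j =>
    o (word_index w * (len c).+1 + j)%N == nth false (bits c a) j)) => j.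
apply: (computable_eq (eA := ebool)).
- by case; case.
- apply: (computable_oracle (f := fun _ w => (word_index w * (len c).+1 + j)%N)).
  exact: computable_add (computable_mulc _ computable_word_index) (computable_const _ _ _).
- exact: computable_const.
Qed.

End Reading.

(** Reduces an inequality of degrees to computing one letter of the target from a word for its
    position. Correctness is asked only on codes of points of [X1], totality on all oracles. *)
Lemma encode_medvedev_le (G1 G2 : groupType) (A1 A2 : finType)
    (c1 : coding G1 A1) (c2 : coding G2 A2) (X1 : set (G1 -> A1)) (X2 : set (G2 -> A2))
    (val : cantor -> seq (letters (gens c2)) -> A2) :
  computable (eseq (@efin _)) (@efin A2) val ->
  (forall x1, X1 x1 -> exists2 x2, X2 x2 &
     forall w, val (encode (x1 \o @rho G1 (gens c1))) w = x2 (swval w)) ->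
  medvedev_le (encode (c := c2) @` pullback (c := c2) X2)
    (encode (c := c1) @` pullback (c := c1) X1).
Proof.
move=> hval valP.
pose out o n := nth false (bits c2 (val o (sval (enumF c2 (n %/ (len c2).+1)))))
                  (n %% (len c2).+1).
have [p hp] : computable enat ebool out.
  apply: (computable_fincase (f := fun o n => val o (sval (enumF c2 (n %/ (len c2).+1))))
      (h := fun _ n a => nth false (bits c2 a) (n %% (len c2).+1))).
    apply: (computable_comp hval (f := fun _ n => sval (enumF c2 (n %/ (len c2).+1)))).
    apply: (computable_comp (computable_enumF c2) (f := fun _ n => (n %/ (len c2).+1)%N)).
    exact: computable_divc (computable_id _).
  by move=> a; apply: computable_nthc; exact: computable_modc (computable_id _).
exists p => _ [_ [x1 /valP[x2 X2x2 hx2] <-] <-].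
exists (encode (x2 \o @rho G2 (gens c2))); last first.
  by exists (x2 \o @rho G2 (gens c2)) => //; exists x2.
by move=> n; have := hp (encode (x1 \o @rho G1 (gens c1))) n; rewrite /out hx2.
Qed.

(** * The degree of T[X] *)

(** A point of [Q] will supply the default letter of [read]; if [Q] is empty, every program is a
    reduction. *)
Lemma medvedev_le_inhabited (P Q : set cantor) :
  (forall x, Q x -> medvedev_le P Q) -> medvedev_le P Q.
Proof.
move=> h; have [[x /h //]|Q0] := pselect (exists x, Q x).
by exists Zero => x Qx; case: Q0; exists x.
Qed.

(** * Part (1): reading the action and a point of $X$ off a point of $T[X]$ *)

Section LowerBound.
Variables (G H : groupType) (S : {fset H}) (F : {fset G}).
Hypotheses (hSgen : generates S) (hSsym : symmetric_set S).
Local Notation B := {ffun S -> F}.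

Lemma Phi_cat g (x : G -> B) (u v : seq S) : Phi g x (u ++ v) = Phi (Phi g x u) x v.
Proof. by rewrite /Phi foldl_cat. Qed.

Lemma wval_word_of h : wval (word_of S h) = h.
Proof. by rewrite /word_of; case: xgetP => // no; have [w /no] := wval_surj hSgen hSsym h. Qed.

(** With [u'] representing the inverse of [u], read the word u u' v in two ways: u'v is a loop at
    the end of u, and uu' is a loop at [g]. *)
Lemma Phi_wval g (x : G -> B) (u v : seq S) :
  bounded_actions S F x -> wval u = wval v -> Phi g x u = Phi g x v.
Proof.
move=> Tx uv; have [u' u'E] := wval_surj hSgen hSsym (wval u)^-1.
have <- : Phi g x (u ++ (u' ++ v)) = Phi g x u.
  by rewrite Phi_cat Tx // wval_cat u'E -uv mulVg.
by rewrite catA Phi_cat (Tx g) // wval_cat u'E mulgV.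
Qed.

Lemma PhiH_wval g (x : G -> B) (w : seq S) :
  bounded_actions S F x -> PhiH g x (wval w) = Phi g x w.
Proof. by move=> Tx; apply: Phi_wval => //; apply: wval_word_of. Qed.

Variables (A : finType) (X : set (H -> A)).
Variable cTX : coding G (A * B)%type.

Lemma bounded_actions_medvedev_le (cT : coding G B) :
  medvedev_le (encode (c := cT) @` pullback (c := cT) (bounded_actions S F))
    (encode (c := cTX) @` pullback (c := cTX) (bounded_actions_over S F X)).
Proof.
apply: medvedev_le_inhabited => _ [_ [x0 _ _] _]; pose a0 := x0 1.
(* The two codings may use different generators of $G$: each letter for [cT] is spelled in those of
   [cTX]. *)
have [tab tabE] := swval_tabulate (@letter G (gens cT)) (gens_generate cTX).
apply: (encode_medvedev_le (val := fun o w => (read a0 o (flatten (map tab w))).2)).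
  apply: (computable_finfun (@efin B) (fun a : A * B => a.2)).
  apply: (computable_comp (computable_read cTX a0) (f := fun _ w => flatten (map tab w))).
  exact: computable_flatmap (computable_id _).
move=> x [Tx _]; exists (fun g => (x g).2) => // w.
by rewrite read_encode (swval_flatmap _ tabE).
Qed.

Lemma subshift_medvedev_le (cX : coding H A) :
  medvedev_le (encode (c := cX) @` pullback (c := cX) X)
    (encode (c := cTX) @` pullback (c := cTX) (bounded_actions_over S F X)).
Proof.
apply: medvedev_le_inhabited => _ [_ [x0 _ _] _]; pose a0 := x0 1.
have [tab tabE] := wval_tabulate (@letter H (gens cX)) hSgen hSsym.
have [step stepE] := swval_tabulate (@fsval _ F) (gens_generate cTX).
(* The walk starts at 1 and keeps a word for the current position: the displacement read there, an
   element of [F], is appended as spelled by [step]. *)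
pose walk o w := foldl (fun u (s : S) => u ++ step ((read a0 o u).2 s)) [::] w.
apply: (encode_medvedev_le
    (val := fun o w => (read a0 o (walk o (flatten (map tab w)))).1)).
  apply: (computable_finfun (@efin A) (fun a : A * B => a.1)).
  apply: (computable_comp (computable_read cTX a0) (f := fun o w => walk o (flatten (map tab w)))).
  apply: (computable_foldl (eA := @efin S) (s := fun _ w => flatten (map tab w))
    (g := fun o _ u (s : S) => u ++ step ((read a0 o u).2 s))).
  - apply: computable_cat; first exact: computable_fst (computable_proj2 _ _).
    apply: (computable_fincase (f := fun o u => read a0 o u.2.1)
      (h := fun _ u (a : A * B) => step (a.2 u.2.2))).
      exact: (computable_comp (computable_read cTX a0) (computable_fst (computable_proj2 _ _))).
    move=> a; apply: (computable_finfun _ (fun s => step (a.2 s))).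
    exact: computable_snd (computable_proj2 _ _).
  - exact: computable_nil.
  - exact: computable_flatmap (computable_id _).
move=> x [Tx Xx]; pose y g := (x g).2.
exists (fun h => (x (PhiH 1 y h)).1); first exact: Xx.
move=> w; rewrite read_encode; congr (x _).1.
set o := encode _; have walkE v : swval (walk o v) = Phi 1 y v.
  elim/last_ind: v => [|v s IHv]; first by rewrite /swval big_nil.
  by rewrite /walk /Phi !foldl_rcons swval_cat -/(walk o v) read_encode IHv stepE.
by rewrite walkE -PhiH_wval // (wval_flatmap _ tabE).
Qed.

Lemma join_medvedev_degree_le (cT : coding G B) (cX : coding H A) :
  mle (msup (medvedev_degree cT (bounded_actions S F)) (medvedev_degree cX X))
      (medvedev_degree cTX (bounded_actions_over S F X)).
Proof.
exists (mjoin (encode (c := cT) @` pullback (c := cT) (bounded_actions S F))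
              (encode (c := cX) @` pullback (c := cX) X)).
exists (encode (c := cTX) @` pullback (c := cTX) (bounded_actions_over S F X))%classic.
split; last by apply: mjoin_le; [apply: bounded_actions_medvedev_le | apply: subshift_medvedev_le].
  do 2!eexists; split; try exact: medvedev_eq_refl.
exact: medvedev_eq_refl.
Qed.

End LowerBound.

(** * Orbits and computable data of a free action *)

Section Action.
Variables (G H : groupType) (act : G -> H -> G).
Hypotheses (hact : right_action act) (hfree : forall g h, act g h = g -> h = 1).

Lemma same_orbit_refl g : same_orbit act g g.
Proof. by exists 1; case: hact. Qed.

Lemma same_orbit_sym g k : same_orbit act g k -> same_orbit act k g.
Proof. by case: hact => h1 hM [h <-]; exists h^-1; rewrite -hM mulgV. Qed.

Lemma same_orbit_trans g k l : same_orbit act g k -> same_orbit act k l -> same_orbit act g l.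
Proof. by case: hact => _ hM [h <-] [h' <-]; exists (h * h'); rewrite hM. Qed.

(** Freeness enters here: a point has only one coordinate relative to a base point of its orbit. *)
Lemma act_inj g : injective (act g).
Proof.
case: hact => h1 hM h k hk.
by apply/divg1_eq/(hfree (g := g)); rewrite hM hk -hM mulgV.
Qed.

End Action.

Lemma computable_action_word (G H : groupType) (R : {fset G}) (S : {fset H})
    (act : G -> H -> G) :
  computable_action R S act ->
  exists2 aw : seq R -> seq S -> seq R,
    (forall u w, wval (aw u w) = act (wval u) (wval w)) &
    computable (eprod (eseq (@efin R)) (eseq (@efin S))) (eseq (@efin R))
      (fun _ u => aw u.1 u.2).
Proof.
case=> p hp.
(* The choice does not spoil computability: each chosen word comes with a run of [p] that outputs
   its code. *)
have [aw awP] := choice (fun u : seq R * seq S => hp u.1 u.2).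
exists (fun u w => aw (u, w)) => [u w|]; first by have [] := awP (u, w).
apply: (computable_prog2 (p := subst Zero p)
   (f1 := fun _ u => eseq (@efin R) u.1) (f2 := fun _ u => eseq (@efin S) u.2)).
- move=> o [u w]; have [h _] := awP (u, w).
  by rewrite -!wcodeE; apply: sem_run.
- exact: computable_proj1.
- exact: computable_proj2.
Qed.

Lemma computable_same_orbit (G H : groupType) (R : {fset G}) (act : G -> H -> G) :
  decidable_orbits R act ->
  computable (eprod (eseq (@efin R)) (eseq (@efin R))) ebool
    (fun _ u => `[< same_orbit act (wval u.1) (wval u.2) >]).
Proof.
case=> p hp.
apply: (computable_prog2 (p := subst Zero p)
   (f1 := fun _ u => eseq (@efin R) u.1) (f2 := fun _ u => eseq (@efin R) u.2)).
- move=> o [u w]; have [b [hb bP]] := hp u w.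
  rewrite -!wcodeE /=; have <- : b = `[< same_orbit act (wval u) (wval w) >].
    by apply/idP/asboolP => /bP.
  exact: sem_run.
- exact: computable_proj1.
- exact: computable_proj2.
Qed.

(** The presentation may use other generators [R']. Equality of two words over [R] becomes
    triviality of the quotient word, spelled over [R'] with one table for the letters and one for
    their inverses. *)
Lemma wval_equality_enumeration (G : groupType) (R : {fset G}) :
  recursively_presented G ->
  exists2 E : nat -> seq R -> seq R -> bool,
    (forall u v, (exists k, E k u v) <-> wval u = wval v) &
    computable (eprod enat (eprod (eseq (@efin R)) (eseq (@efin R)))) ebool
      (fun _ u => E u.1 u.2.1 u.2.2).
Proof.
case=> R' genR' /re_words_enumeration[P PE hP].
have [tab tabE] := swval_tabulate (@fsval _ R) genR'.
have [tabV tabVE] := swval_tabulate (fun r : R => (fsval r)^-1) genR'.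
pose word (u v : seq R) : seq (letters R') :=
  flatten (map tabV (rev u)) ++ flatten (map tab v).
have wordE u v : swval (word u v) = (wval u)^-1 * wval v.
  rewrite swval_cat (swval_flatmap _ tabE) (swval_flatmap _ tabVE); congr (_ * _).
  elim: u => [|r u IHu]; first by rewrite /wval !big_nil invg1.
  by rewrite rev_cons big_rcons IHu wval_cons invgM.
exists (fun k u v => P k (word u v)).
  move=> u v; rewrite PE /= wordE; split=> [/(congr1 (fun g => wval u * g))|->].
    by rewrite mulVKg mulg1.
  by rewrite mulVg.
apply: (computable_comp hP (f := fun _ u => (u.1, word u.2.1 u.2.2))).
apply: computable_pair; first exact: computable_proj1.
apply: computable_cat; apply: computable_flatmap.
  apply: computable_rev; exact: computable_fst (computable_proj2 _ _).
exact: computable_snd (computable_proj2 _ _).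
Qed.

(** * Part (2): transporting a point of $X$ along the orbits of a computable action *)

Section UpperBound.
Variables (G H : groupType) (S : {fset H}) (F : {fset G}).
Hypotheses (hSgen : generates S) (hSsym : symmetric_set S).
Hypothesis hGrp : recursively_presented G.
Variables (act : G -> H -> G) (R : {fset G}).
Hypotheses (hact : right_action act) (hfree : forall g h, act g h = g -> h = 1).
Hypothesis hF : forall g s, s \in S -> g^-1 * act g s \in F.
Hypotheses (hRgen : generates R) (hRsym : symmetric_set R).
Hypotheses (hcomp : computable_action R S act) (hdec : decidable_orbits R act).
Local Notation B := {ffun S -> F}.

Lemma orbit_index_exists (u : seq R) :
  exists n, `[< same_orbit act (wval (decode_word R n)) (wval u) >].
Proof. by exists (eseq (@efin _) u); apply/asboolP; rewrite eseqK; exact: same_orbit_refl. Qed.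

Definition orbit_word (u : seq R) : seq R := decode_word R (ex_minn (orbit_index_exists u)).

Lemma orbit_word_same (u : seq R) : same_orbit act (wval (orbit_word u)) (wval u).
Proof. by rewrite /orbit_word; case: ex_minnP => n /asboolP. Qed.

(** Both searches pass exactly the same tests, so their minima agree. The equality is one of words,
    obtained without comparing elements of $G$. *)
Lemma orbit_word_eq (u v : seq R) :
  same_orbit act (wval u) (wval v) -> orbit_word u = orbit_word v.
Proof.
move=> uv; rewrite /orbit_word; congr decode_word; apply: eq_ex_minn => n.
by apply/asboolP/asboolP => h; apply: same_orbit_trans h _ => //; apply: same_orbit_sym.
Qed.

Lemma computable_orbit_word :
  computable (eseq (@efin R)) (eseq (@efin R)) (fun _ u => orbit_word u).
Proof.
apply: (computable_comp (computable_decode_word R)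
  (f := fun _ u => ex_minn (orbit_index_exists u))).
apply: (computable_search (fun _ => orbit_index_exists)
  (P := fun _ u n => `[< same_orbit act (wval (decode_word R n)) (wval u) >])).
apply: (computable_comp (computable_same_orbit hdec) (f := fun _ u => (decode_word R u.2, u.1))).
apply: computable_pair; last exact: computable_proj1.
exact: (computable_comp (computable_decode_word R) (computable_proj2 _ _)).
Qed.

(* Searching simultaneously for a word of [H] and for a proof that it moves the
   base point of the orbit to [u]. *)
Lemma computable_coordinate :
  exists2 f : seq R -> seq S,
    (forall u, act (wval (orbit_word u)) (wval (f u)) = wval u) &
    computable (eseq (@efin R)) (eseq (@efin S)) (fun _ u => f u).
Proof.
have [aw awE haw] := computable_action_word hcomp.
have [E EE hE] := wval_equality_enumeration R hGrp.
(* A number is read as a sequence: entry 0 is a stage in the enumeration of equalities, entry 1 the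
   code of a word over [S]. *)
pose w n := decode_word S (nth 0%N (CodeSeq.decode n) 1).
pose P u n := E (nth 0%N (CodeSeq.decode n) 0) (aw (orbit_word u) (w n)) u.
have exP u : exists n, P u n.
  have [h hu] := orbit_word_same u; have [v vh] := wval_surj hSgen hSsym h.
  have [_ /(_ _)[|k Ek]] := EE (aw (orbit_word u) v) u; first by rewrite awE vh.
  exists (CodeSeq.code [:: k; eseq (@efin S) v]).
  by rewrite /P /w CodeSeq.codeK /= eseqK.
have hdecode : computable enat (eseq enat) (fun _ n => CodeSeq.decode n).
  by exists (Proj 0) => o n; rewrite eseq_nat CodeSeq.decodeK.
have hw : computable enat (eseq (@efin S)) (fun _ n => w n).
  exact: (computable_comp (computable_decode_word S) (computable_nth _ hdecode)).
exists (fun u => w (ex_minn (exP u))).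
  move=> u; case: ex_minnP => n Pn _.
  by rewrite -awE; apply/EE; exists (nth 0%N (CodeSeq.decode n) 0).
apply: (computable_comp hw (f := fun _ u => ex_minn (exP u))).
apply: (computable_search (fun _ => exP) (P := fun _ => P)).
apply: (computable_comp hE (f := fun _ u =>
  (nth 0%N (CodeSeq.decode u.2) 0, (aw (orbit_word u.1) (w u.2), u.1)))).
apply: computable_pair.
  exact: computable_nth (computable_comp hdecode (computable_proj2 _ _)).
apply: computable_pair; last exact: computable_proj1.
apply: (computable_comp haw (f := fun _ u => (orbit_word u.1, w u.2))).
apply: computable_pair; first exact: (computable_comp computable_orbit_word (computable_proj1 _ _)).
exact: (computable_comp hw (computable_proj2 _ _)).
Qed.

Definition displacement (g : G) : B := [ffun s : S => [` hF g (fsvalP s)]%fset].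

Lemma displacementE g (s : S) : g * fsval (displacement g s) = act g (fsval s).
Proof. by rewrite ffunE mulVKg. Qed.

Lemma Phi_displacement g (w : seq S) : Phi g displacement w = act g (wval w).
Proof.
case: hact => act1 actM; elim/last_ind: w => [|w s IHw].
  by rewrite /Phi /wval big_nil act1.
rewrite /Phi foldl_rcons -/(Phi g displacement w) displacementE IHw -actM.
by rewrite /wval big_rcons.
Qed.

Lemma computable_displacement (L : {fset G}) (tab : L * bool -> seq R) :
  (forall a, wval (tab a) = letter a) ->
  computable (eseq (@efin (letters L))) (@efin B) (fun _ w => displacement (swval w)).
Proof.
move=> tabE.
have [aw awE haw] := computable_action_word hcomp.
have [E EE hE] := wval_equality_enumeration R hGrp.
have [tF tFE] := wval_tabulate (@fsval _ F) hRgen hRsym.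
pose t (w : seq (letters L)) : seq R := flatten (map tab w).
have tE w : wval (t w) = swval w by rewrite (wval_flatmap _ tabE).
have ht : computable (eseq (@efin (letters L))) (eseq (@efin R)) (fun _ w => t w).
  exact: computable_flatmap (computable_id _).
apply: computable_ffun => s.
(* Cancelling [swval w] on the left leaves exactly one [f] that is ever accepted, as dovetailing
   demands. *)
apply: (computable_dovetail (P := fun _ w f k => E k (aw (t w) [:: s]) (t w ++ tF f))).
  move=> o w f; rewrite EE awE wval_cat tFE tE /wval big_seq1 -displacementE.
  by split=> [/mulgI/val_inj|->].
move=> f; apply: (computable_comp hE (f := fun _ u => (u.2, (aw (t u.1) [:: s], t u.1 ++ tF f)))).
have ht1 : computable (eprod (eseq (@efin (letters L))) enat) (eseq (@efin R)) (fun _ u => t u.1).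
  exact: (computable_comp ht (computable_proj1 _ _)).
apply: computable_pair; first exact: computable_proj2.
apply: computable_pair; last exact: computable_cat ht1 (computable_const _ _ _).
apply: (computable_comp haw (f := fun _ u => (t u.1, [:: s]))).
exact: computable_pair ht1 (computable_const _ _ _).
Qed.

Lemma bounded_actions_over_medvedev_le (A : finType) (X : set (H -> A))
    (cTX : coding G (A * B)%type) (cX : coding H A) :
  subshift X ->
  medvedev_le (encode (c := cTX) @` pullback (c := cTX) (bounded_actions_over S F X))
    (encode (c := cX) @` pullback (c := cX) X).
Proof.
move=> [_ shiftX]; apply: medvedev_le_inhabited => _ [_ [x0 _ _] _]; pose a0 := x0 1.
have [f fE hf] := computable_coordinate.
have [tab tabE] := wval_tabulate (@letter G (gens cTX)) hRgen hRsym.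
have [tX tXE] := swval_tabulate (@fsval _ S) (gens_generate cX).
have [word wordE] := choice (wval_surj hRgen hRsym).
pose t (w : seq (letters (gens cTX))) : seq R := flatten (map tab w).
have tE w : wval (t w) = swval w by rewrite (wval_flatmap _ tabE).
pose coord g := wval (f (word g)).
(* The word [f u] may vary with the word [u], but its value depends only on [wval u]: the base word
   is the same, and [act_inj] applies. *)
have coordE u : wval (f u) = coord (wval u).
  apply: (act_inj hact hfree (g := wval (orbit_word u))); rewrite fE.
  rewrite (@orbit_word_eq u (word (wval u))) ?fE ?wordE //.
  exact: same_orbit_refl.
(* Equivariance holds because [g] and its image under [h] share a base point; both sides move that
   point to the same place. *)
have coord_act g h : coord (act g h) = coord g * h.
  apply: (act_inj hact hfree (g := wval (orbit_word (word (act g h))))).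
  rewrite fE wordE (@orbit_word_eq _ (word g)); last first.
    by rewrite !wordE; apply: same_orbit_sym => //; exists h.
  by case: hact => _ ->; rewrite fE wordE.
apply: (encode_medvedev_le (val := fun o w =>
  (read a0 o (flatten (map tX (f (t w)))), displacement (swval w)))).
  (* A letter is coded by its rank in the product alphabet, not by [eprod], so the pair is assembled
     by finite case distinctions on its components. *)
  apply: (computable_ext (f := fun o w => (fun a b => (a, b))
    (read a0 o (flatten (map tX (f (t w))))) (displacement (swval w)))) => //.
  apply: (computable_fincase (f := fun _ w => displacement (swval w))
    (h := fun o w b => (read a0 o (flatten (map tX (f (t w)))), b))).
    exact: computable_displacement tabE.
  move=> b; apply: (computable_finfun _ (fun a => (a, b))).
  apply: (computable_comp (computable_read cX a0) (f := fun _ w => flatten (map tX (f (t w))))).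
  apply: computable_flatmap; apply: (computable_comp hf (f := fun _ w => t w)).
  exact: computable_flatmap (computable_id _).
move=> x Xx; exists (fun g => (x (coord g), displacement g)); last first.
  by move=> w; rewrite read_encode (swval_flatmap _ tXE) -/(wval _) coordE tE.
split=> [g w w1 | g] /=.
  by rewrite Phi_displacement w1; case: hact.
(* Along the orbit of [g] the labels are x(coord(g) h), a shift of [x]; the inverse offsets the one
   in the definition of [shift]. *)
have -> : (fun h => x (coord (PhiH g displacement h))) = shift (coord g)^-1 x.
  apply: funext => h.
  by rewrite /PhiH Phi_displacement (wval_word_of hSgen hSsym) coord_act /shift invgK.
exact: shiftX.
Qed.

End UpperBound.

Theorem proposition4p14
  (G H : groupType) (hG : finitely_generated G) (hH : finitely_generated H)
  (S : {fset H}) (hSgen : generates S) (hSsym : symmetric_set S) (F : {fset G}) :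
  (forall (A : finType) (X : set (H -> A)), subshift X ->
     forall (cTX : coding G (A * {ffun S -> F})%type)
            (cT : coding G {ffun S -> F}) (cX : coding H A),
       mle (msup (medvedev_degree cT (bounded_actions S F))
                 (medvedev_degree cX X))
           (medvedev_degree cTX (bounded_actions_over S F X)))
  /\
  (recursively_presented G ->
   (exists (act : G -> H -> G) (R : {fset G}),
      [/\ translation_like S act,
          forall g s, s \in S -> g^-1 * act g s \in F,
          generates R /\ symmetric_set R,
          computable_action R S act
        & decidable_orbits R act]) ->
   forall (A : finType) (X : set (H -> A)), subshift X ->
     forall (cTX : coding G (A * {ffun S -> F})%type) (cX : coding H A),
       medvedev_degree cTX (bounded_actions_over S F X)
       = medvedev_degree cX X).
Proof.
split=> [A X _ cTX cT cX|hGrp [act [R [[hact hfree _] hF [hRgen hRsym] hcomp hdec]]] A X hX cTX cX].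
  exact: join_medvedev_degree_le.
apply: mdegree_eq; split; first exact: bounded_actions_over_medvedev_le hdec _ _ _ _ hX.
(* The other inequality is one of the two halves of part (1). *)
exact: subshift_medvedev_le.
Qed.
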